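(* Let $\alpha,\beta\in\{1,2\}$ with $\beta\neq\alpha$. Let $\mathcal H_1,\mathcal H_2$ be Hilbert spaces, let $A_1,A_2$ be (possibly unbounded) self-adjoint operators in $\mathcal H_1$ and $\mathcal H_2$ respectively, with spectra $\sigma_1=\sigma(A_1)$, $\sigma_2=\sigma(A_2)$ satisfying $d_0:=\operatorname{dist}(\sigma_1,\sigma_2)>0$. Let $B_{\alpha\beta}:\mathcal H_\beta\to\mathcal H_\alpha$ be a Hilbert--Schmidt operator with Hilbert--Schmidt norm $\|B_{\alpha\beta}\|_2$, and let $B_{\beta\alpha}=B_{\alpha\beta}^*:\mathcal H_\alpha\to\mathcal H_\beta$. Let $E_\beta$ be the spectral measure of $A_\beta$. Consider the equation $$Q_{\beta\alpha}=\int_{\sigma_\beta}E_\beta(d\mu)\,B_{\beta\alpha}\,\bigl(A_\alpha+B_{\alpha\beta}Q_{\beta\alpha}-\mu I_\alpha\bigr)^{-1}\qquad( * )$$ for an unknown bounded operator $Q_{\beta\alpha}:\mathcal H_\alpha\to\mathcal H_\beta$. For $\delta>0$ let $M_{\beta\alpha}(\delta)$ be the set of bounded operators $X:\mathcal H_\alpha\to\mathcal H_\beta$ with $\|X\|\le\delta$. If $\delta>0$ and $$\|B_{\alpha\beta}\|_2<d_0\,\min\Bigl\{\frac{1}{1+\delta},\ \frac{\delta}{1+\delta^2}\Bigr\},$$ then equation $( * )$ is uniquely solvable in $M_{\beta\alpha}(\delta)$. In particular, $( * )$ is uniquely solvable in the unit ball $M_{\beta\alpha}(1)$ for any $B_{\alpha\beta}$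 with $\|B_{\alpha\beta}\|_2<\frac12 d_0$.
   Context: $I_\alpha$ is the identity operator in $\mathcal H_\alpha$; $\|\cdot\|$ is the operator norm and $\|\cdot\|_2$ the Hilbert--Schmidt norm. For an operator $Y$ in $\mathcal H_\alpha$ with $\sup_{\mu\in\sigma_\beta}\|(Y-\mu I_\alpha)^{-1}\|<\infty$, the integral $\int_{\sigma_\beta}E_\beta(d\mu)B_{\beta\alpha}(Y-\mu I_\alpha)^{-1}$ is constructed in the same way as integrals of scalar functions over a spectral measure: for $a<b$ one takes the norm limit of the sums $\sum_k E_\beta(\Delta_k)B_{\beta\alpha}(Y-\mu_kI_\alpha)^{-1}$ over finite partitions of $\sigma_\beta\cap[a,b)$ into Borel sets $\Delta_k$ with $\mu_k\in\Delta_k$, as the mesh tends to $0$, and then lets $a\to-\infty$, $b\to+\infty$ (since $B_{\beta\alpha}$ is Hilbert--Schmidt, this integral exists as a bounded operator from $\mathcal H_\alpha$ to $\mathcal H_\beta$). In $( * )$ it is applied to $Y=A_\alpha+B_{\alpha\beta}Q_{\beta\alpha}$ with domain $\mathcal D(A_\alpha)$. *)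

(* Defs.v *)
From HB Require Import structures.
From mathcomp Require Import all_boot all_order all_algebra.
From mathcomp Require Import complex.
From mathcomp Require Import all_classical all_reals all_analysis.

Set Implicit Arguments.
Unset Strict Implicit.
Unset Printing Implicit Defensive.

Import Order.TTheory GRing.Theory Num.Theory.
Import numFieldNormedType.Exports.

Local Open Scope classical_set_scope.
Local Open Scope complex_scope.
Local Open Scope ring_scope.

(* Complex Hilbert spaces; the inner product is linear in its first argument
   and induces the norm of the underlying Banach space. *)
HB.mixin Record CompleteNormedModule_isHilbert (R : realType) H
    of CompleteNormedModule R[i] H := {
  ip : H -> H -> R[i];
  ip_linearl : forall (c : R[i]) (x y z : H),
    ip (c *: x + y) z = c * ip x z + ip y z;
  ip_conj : forall x y : H, ip y x = (ip x y)^*%R;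
  ip_norm : forall x : H, ip x x = `|x| ^+ 2
}.

#[short(type="hilbertType")]
HB.structure Definition Hilbert (R : realType) :=
  { H of CompleteNormedModule R[i] H & CompleteNormedModule_isHilbert R H }.

(* Norms over R[i] take values in R[i]; rnorm is the same number as an element
   of R. *)
Definition rnorm (R : realType) (V : normedZmodType R[i]) (x : V) : R :=
  complex.Re `|x|.

Section BoundedOperators.
Variable R : realType.

Definition bounded_operator (U V : hilbertType R) (T : U -> V) : Prop :=
  linear T /\ continuous T.

Definition opnorm (U V : hilbertType R) (T : U -> V) : \bar R :=
  ereal_sup [set (rnorm (T x))%:E | x in [set x | rnorm x <= 1]].

Definition operator_ball (U V : hilbertType R) (delta : R) : set (U -> V) :=
  [set X | bounded_operator X /\ (opnorm X <= delta%:E)%E].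

Definition is_adjoint (U V : hilbertType R) (T : U -> V) (T' : V -> U) : Prop :=
  forall x y, ip (T x) y = ip x (T' y).

Definition orthogonal_projection (U : hilbertType R) (P : U -> U) : Prop :=
  [/\ bounded_operator P, P \o P = P & is_adjoint P P].

Definition orthonormal_basis (U : hilbertType R) (S : set U) : Prop :=
  [/\ forall e, S e -> ip e e = 1,
      forall e f, S e -> S f -> e <> f -> ip e f = 0
    & forall x, (forall e, S e -> ip x e = 0) -> x = 0].

(* The sum does not depend on the orthonormal basis of U that is chosen. *)
Definition hs_norm (U V : hilbertType R) (T : U -> V) : \bar R :=
  sqrte (\esum_(e in xget set0 [set S : set U | orthonormal_basis S])
           ((rnorm (T e)) ^+ 2)%:E).

Definition hilbert_schmidt (U V : hilbertType R) (T : U -> V) : Prop :=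
  bounded_operator T /\ (hs_norm T < +oo)%E.

End BoundedOperators.

(* The values of oper outside dom are irrelevant. *)
Record operator (R : realType) (U : hilbertType R) := Operator {
  dom : set U;
  oper :> U -> U }.

Section UnboundedOperators.
Variables (R : realType) (U : hilbertType R).
Implicit Types (A Y : operator U) (z : R[i]).

Definition linear_operator A : Prop :=
  dom A 0 /\
  forall (c : R[i]) x y, dom A x -> dom A y ->
    dom A (c *: x + y) /\ A (c *: x + y) = c *: A x + A y.

(* y is in the domain of the adjoint and is mapped by it to y' *)
Definition adjoint_graph A (y y' : U) : Prop :=
  forall x, dom A x -> ip (A x) y = ip x y'.

Definition self_adjoint A : Prop :=
  [/\ linear_operator A, dense (dom A)
    & forall y y', adjoint_graph A y y' <-> dom A y /\ A y = y'].

Definition add_operator A (K : U -> U) : operator U :=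
  Operator (dom A) (fun x => A x + K x).

Definition is_resolvent Y z (T : U -> U) : Prop :=
  [/\ bounded_operator T,
      forall x, dom Y (T x) /\ Y (T x) - z *: T x = x
    & forall x, dom Y x -> T (Y x - z *: x) = x].

Definition resolvent_set Y : set R[i] := [set z | exists T, is_resolvent Y z T].

Definition spectrum Y : set R[i] := ~` resolvent_set Y.

(* The spectrum of a self-adjoint operator is real; this is that spectrum as a
   set of elements of R, on which E(dmu) is integrated. *)
Definition real_spectrum Y : set R := [set mu | spectrum Y mu%:C].

(* (Y - z)^-1; a junk value when z is in the spectrum of Y *)
Definition resolvent Y z : U -> U := xget (fun=> 0) (is_resolvent Y z).

End UnboundedOperators.

Definition set_dist (R : realType) (S T : set R[i]) : \bar R :=
  ereal_inf [set (rnorm (p.1 - p.2 : R[i]))%:E | p in S `*` T].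

Section SpectralIntegral.
Variable R : realType.

Definition tagged_partition (S : set R) n (D : 'I_n -> set R) (t : 'I_n -> R)
    : Prop :=
  [/\ forall k, measurable (D k), trivIset setT D,
      \bigcup_k D k = S & forall k, D k (t k)].

Definition mesh_lt n (D : 'I_n -> set R) (eta : R) : Prop :=
  forall k s t, D k s -> D k t -> `|s - t| < eta.

(* J is the limit in operator norm, as the mesh tends to 0, of the sums
   of F (D k) (t k) over tagged partitions of S. *)
Definition is_integral_on (U V : hilbertType R) (F : set R -> R -> U -> V)
    (S : set R) (J : U -> V) : Prop :=
  bounded_operator J /\
  forall eps : R, 0 < eps -> exists2 eta : R, 0 < eta &
    forall n (D : 'I_n -> set R) (t : 'I_n -> R),
      tagged_partition S D t -> mesh_lt D eta ->
      (opnorm (fun x => \sum_(k < n) F (D k) (t k) x - J x)%R < eps%:E)%E.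

Definition is_projection_valued_measure (U : hilbertType R)
    (E : set R -> U -> U) : Prop :=
  [/\ forall D, measurable D -> orthogonal_projection (E D),
      E setT = id
    & forall D : (set R)^nat, (forall n, measurable (D n)) -> trivIset setT D ->
        forall x, (\sum_(0 <= k < n) E (D k) x) @[n --> \oo]
                    --> E (\bigcup_n D n) x].

(* A is the integral of mu E(dmu) over R: the domain of A consists of the x for
   which mu is square integrable with respect to the measure |E(.)x|^2, and A x
   is there the limit of the integrals over [a, b[ applied to x. *)
Definition is_spectral_measure (U : hilbertType R) (E : set R -> U -> U)
    (A : operator U) : Prop :=
  [/\ is_projection_valued_measure E,
      dom A = [set x | (\int[fun D => ((rnorm (E D x)) ^+ 2)%:E]_(mu in setT)
                          (mu ^+ 2)%:E < +oo)%E]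
    & exists2 J : R -> R -> U -> U,
        forall a b, a < b ->
          is_integral_on (fun D mu x => mu%:C *: E D x) `[a, b[ (J a b)
      & forall x, dom A x -> forall eps : R, 0 < eps ->
          \forall a \near -oo & b \near +oo, rnorm (J a b x - A x) < eps].

(* I is the integral over sigma of E(dmu) B G(mu), the limit for a -> -oo and
   b -> +oo being taken in operator norm. *)
Definition is_spectral_integral (U V : hilbertType R) (E : set R -> V -> V)
    (sigma : set R) (B : U -> V) (G : R -> U -> U) (I : U -> V) : Prop :=
  exists2 J : R -> R -> U -> V,
    forall a b, a < b ->
      is_integral_on (fun D mu => E D \o B \o G mu) (sigma `&` `[a, b[) (J a b)
  & forall eps : R, 0 < eps ->
      \forall a \near -oo & b \near +oo, (opnorm (J a b \- I)%R < eps%:E)%E.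

(* Q is the integral over sigma of E(dmu) Bvu (A + Buv Q - mu)^-1. The existence
   and uniform boundedness of the resolvent on sigma, which give a meaning to the
   integral, are part of being a solution. *)
Definition is_solution (U V : hilbertType R) (A : operator U)
    (E : set R -> V -> V) (sigma : set R) (Buv : V -> U) (Bvu : U -> V)
    (Q : U -> V) : Prop :=
  let Y := add_operator A (Buv \o Q) in
  [/\ forall mu, sigma mu -> resolvent_set Y mu%:C,
      (ereal_sup [set opnorm (resolvent Y mu%:C) | mu in sigma] < +oo)%E
    & is_spectral_integral E sigma Bvu (fun mu => resolvent Y mu%:C) Q].

End SpectralIntegral.

(* Main.v *)
Require Import Defs.
From mathcomp Require Import all_boot all_order all_algebra.
From mathcomp Require Import complex ring lra.
From mathcomp Require Import all_classical all_reals all_analysis.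

Set Implicit Arguments.
Unset Strict Implicit.
Unset Printing Implicit Defensive.

Import Order.TTheory GRing.Theory Num.Theory.
Import numFieldNormedType.Exports.

Local Open Scope classical_set_scope.
Local Open Scope complex_scope.
Local Open Scope ring_scope.

(* The map sending Q to the integral on the right-hand side of the equation is a
   contraction of the operator ball of radius delta. Write b for the
   Hilbert-Schmidt norm of Bab and d for a lower bound of the distance of the
   spectra. Since A is self-adjoint, |(A - mu)^-1| <= 1/d for mu in sigma, so a
   Neumann series bounds (A + Bab Q - mu)^-1 by C = 1/(d - b delta). For disjoint
   D_k and |G_k| <= c, the sum of the E(D_k) Bba G_k has norm at most c b: this is
   where Bab has to be Hilbert-Schmidt, an operator norm bound would not do. It
   gives the existence of the integral, the bound b C <= delta for it, and the
   Lipschitz constant (b C)^2 < 1 in Q. *)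

(** In a sum of [E(D_k) Bba G_k] the [G_k] vary with [k]. The pieces are orthogonal, but an operator
    norm bound on [Bba] would only give a sum of [n] squares that need not shrink as the partition
    is refined. Moving [Bba] to its adjoint [Bab] leads instead to a sum of [|Bab f_k|^2] with
    orthogonal [f_k] in the ranges of the [E(D_k)]. These [f_k] depend on the sum at hand, whereas
    [hs_norm] fixes one basis; so the Hilbert-Schmidt bound has to be extended to all finite
    orthogonal families in the unit ball.

    The two terms of the minimum are the two requirements on [b C]: [b C < 1] amounts to
    [b (1 + delta) < d], and [b C <= delta] follows from [b (1 + delta^2) < d delta]. The square in
    the Lipschitz constant comes from the resolvent identity: [G_Q - G_Q' = G_Q' Bab (Q' - Q) G_Q]
    has norm at most [C b C |Q - Q'|], and integration contributes one more [b]. *)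

Section RealNorm.
Variables (R : realType) (V : normedZmodType R[i]).
Implicit Types (x y : V).

Lemma normr_rnorm x : `|x| = (rnorm x)%:C.
Proof.
by have := normr_ge0 x; rewrite lecE /= /rnorm; case: `|x| => a b /= /andP[/eqP-> _].
Qed.

Lemma rnorm_ge0 x : 0 <= rnorm x.
Proof. by have := normr_ge0 x; rewrite lecE => /andP[]. Qed.

Lemma rnorm0 : rnorm (0 : V) = 0.
Proof. by rewrite /rnorm normr0. Qed.

Lemma rnorm_eq0 x : rnorm x = 0 -> x = 0.
Proof. by move=> h; apply/normr0_eq0; rewrite normr_rnorm h. Qed.

Lemma rnormN x : rnorm (- x) = rnorm x.
Proof. by rewrite /rnorm normrN. Qed.

Lemma rdistC x y : rnorm (x - y) = rnorm (y - x).
Proof. by rewrite /rnorm distrC. Qed.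

Lemma ler_rnormD x y : rnorm (x + y) <= rnorm x + rnorm y.
Proof.
by have := ler_normD x y; rewrite !normr_rnorm -rmorphD /= lecE /= => /andP[].
Qed.

Lemma ler_rnormB x y : rnorm (x - y) <= rnorm x + rnorm y.
Proof. by rewrite -(rnormN y); exact: ler_rnormD. Qed.

Lemma ler_rdist x y z : rnorm (x - z) <= rnorm (x - y) + rnorm (y - z).
Proof. by rewrite (_ : x - z = (x - y) + (y - z)) ?ler_rnormD// addrA subrK. Qed.

End RealNorm.

Lemma rnorm_real (R : realType) (a : R) : rnorm (a%:C : R[i]) = `|a|.
Proof. by rewrite /rnorm normc_def /= expr0n addr0 sqrtr_sqr. Qed.

Lemma Re_le_rnorm (R : realType) (c : R[i]) : `|complex.Re c| <= rnorm c.
Proof. by have := normc_ge_Re c; rewrite lecE => /andP[]. Qed.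

Lemma rnormM (R : realType) (c d : R[i]) : rnorm (c * d) = rnorm c * rnorm d.
Proof. by rewrite {1}/rnorm normrM !normr_rnorm -rmorphM. Qed.

Lemma rnorm_sqr (R : realType) (c : R[i]) : c * c^*%R = (rnorm c ^+ 2)%:C.
Proof. by rewrite -normCK normr_rnorm -rmorphXn. Qed.

(** * Convergence and completeness through real-valued norms *)

Section Sequences.
Variables (R : realType) (V : completeNormedModType R[i]).
Implicit Types (x y : V) (u : nat -> V).

Lemma rnormZ (c : R[i]) x : rnorm (c *: x) = rnorm c * rnorm x.
Proof. by rewrite {1}/rnorm normrZ !normr_rnorm -rmorphM. Qed.

Lemma rnormZr (a : R) x : rnorm (a%:C *: x) = `|a| * rnorm x.
Proof. by rewrite rnormZ rnorm_real. Qed.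

Lemma nbhs_rnorm x (A : set V) :
  nbhs x A <-> exists2 e : R, 0 < e & forall y, rnorm (x - y) < e -> A y.
Proof.
split=> [/nbhs_ballP [e /= e0 h]|[e e0 h]].
  (* A positive element of [R[i]] has zero imaginary part, so a radius there is a real radius. *)
  move: e0; rewrite ltcE => /andP[/eqP /= ei er].
  exists (complex.Re e) => // y hy; apply: h; rewrite -ball_normE /=.
  rewrite normr_rnorm ltcE /= ei eqxx /=. exact: hy.
apply/nbhs_ballP; exists e%:C; first by rewrite /= ltcR.
move=> y; rewrite -ball_normE /= normr_rnorm ltcR; exact: h.
Qed.

Lemma cvg_rnorm u x :
  u @ \oo --> x <->
  forall e : R, 0 < e -> exists N, forall n, (N <= n)%N -> rnorm (u n - x) < e.
Proof.
split=> [h e e0|h A /nbhs_rnorm [e e0 hA]].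
  have [|N _ hN] := h [set y | rnorm (x - y) < e].
    by apply/nbhs_rnorm; exists e.
  by exists N => n /hN; rewrite /= rdistC.
have [N hN] := h e e0; exists N => // n /hN; rewrite rdistC; exact: hA.
Qed.

Lemma complete_rnorm u :
  (forall e : R, 0 < e -> exists N, forall m n, (N <= m)%N -> (N <= n)%N ->
     rnorm (u m - u n) < e) ->
  exists x, forall e : R, 0 < e ->
    exists N, forall n, (N <= n)%N -> rnorm (u n - x) < e.
Proof.
move=> h; have : cauchy (u @ \oo).
  apply: cauchy_exP => e; rewrite ltcE => /andP[/eqP /= ei er].
  have [N hN] := h _ er; exists (u N); exists N => // n /= /(fun k => hN N n (leqnn N) k).
  by rewrite -ball_normE /= normr_rnorm ltcE /= ei eqxx.
by move=> /cauchy_cvg /cvg_ex [x /cvg_rnorm hx]; exists x.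
Qed.

(** The factor [C] absorbs all error terms that an estimate collects, so that [e] need not be split
    in advance. *)
Lemma le_eps (a b C : R) :
  (forall e, 0 < e -> a <= b + e * C) -> a <= b.
Proof.
move=> h; apply/ler_addgt0Pr => e e0.
have C0 : 0 < `|C| + 1 by rewrite ltr_pwDr.
apply: le_trans (h (e / (`|C| + 1)) _) _; first by rewrite divr_gt0.
rewrite lerD2l -mulrA ler_piMr ?(ltW e0)// mulrC ler_pdivrMr// mul1r.
by rewrite (le_trans (ler_norm C))// lerDl.
Qed.

Lemma le_eps0 (a C : R) : 0 <= a -> (forall e, 0 < e -> a <= e * C) -> a = 0.
Proof.
move=> a0 h; apply/le_anti/andP; split => //.
by apply: (@le_eps _ _ C) => e e0; rewrite add0r h.
Qed.

End Sequences.

(** * Inner products and the Cauchy-Schwarz inequality *)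

Section Hilbert.
Variables (R : realType) (H : hilbertType R).
Implicit Types (x y z : H) (c : R[i]).

Lemma ip0l x : ip 0 x = 0.
Proof.
have := ip_linearl 1 (0 : H) 0 x; rewrite scaler0 addr0 mul1r => h.
by apply: (@addrI _ (ip 0 x)); rewrite addr0 -h.
Qed.

Lemma ipDl x y z : ip (x + y) z = ip x z + ip y z.
Proof. by have := ip_linearl 1 x y z; rewrite scale1r mul1r. Qed.

Lemma ipZl c x y : ip (c *: x) y = c * ip x y.
Proof. by have := ip_linearl c x 0 y; rewrite addr0 ip0l addr0. Qed.

Lemma ipNl x y : ip (- x) y = - ip x y.
Proof. by rewrite -scaleN1r ipZl mulN1r. Qed.

Lemma ipBl x y z : ip (x - y) z = ip x z - ip y z.
Proof. by rewrite ipDl ipNl. Qed.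

Lemma ip_suml (I : Type) (s : seq I) (F : I -> H) y :
  ip (\sum_(i <- s) F i) y = \sum_(i <- s) ip (F i) y.
Proof.
by elim/big_rec2: _ => [|i b a _ h]; rewrite ?ip0l// ipDl h.
Qed.

Lemma ip0r x : ip x 0 = 0.
Proof. by rewrite ip_conj ip0l rmorph0. Qed.

Lemma ipDr x y z : ip z (x + y) = ip z x + ip z y.
Proof. by rewrite ip_conj ipDl rmorphD /= -!ip_conj. Qed.

Lemma ipZr c x y : ip x (c *: y) = c^*%R * ip x y.
Proof. by rewrite ip_conj ipZl rmorphM /= -ip_conj. Qed.

Lemma ipNr x y : ip x (- y) = - ip x y.
Proof. by rewrite ip_conj ipNl rmorphN /= -ip_conj. Qed.

Lemma ipBr x y z : ip z (x - y) = ip z x - ip z y.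
Proof. by rewrite ipDr ipNr. Qed.

Lemma ip_sumr (I : Type) (s : seq I) (F : I -> H) y :
  ip y (\sum_(i <- s) F i) = \sum_(i <- s) ip y (F i).
Proof.
by elim/big_rec2: _ => [|i b a _ h]; rewrite ?ip0r// ipDr h.
Qed.

Lemma ip_eq0C x y : ip x y = 0 -> ip y x = 0.
Proof. by move=> h; rewrite ip_conj h rmorph0. Qed.

Lemma ipxx x : ip x x = (rnorm x ^+ 2)%:C.
Proof. by rewrite ip_norm normr_rnorm -rmorphXn. Qed.

(** The underlying real inner product, symmetric and bilinear over [R], whose values can enter order
    arguments. *)
Definition rip x y : R := complex.Re (ip x y).

Lemma ripC x y : rip x y = rip y x.
Proof. by rewrite /rip ip_conj; case: (ip y x). Qed.

Lemma ripxx x : rip x x = rnorm x ^+ 2.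
Proof. by rewrite /rip ipxx. Qed.

Lemma ripDl x y z : rip (x + y) z = rip x z + rip y z.
Proof. by rewrite /rip ipDl raddfD. Qed.

Lemma ripNl x y : rip (- x) y = - rip x y.
Proof. by rewrite /rip ipNl raddfN. Qed.

Lemma ripZl (a : R) x y : rip (a%:C *: x) y = a * rip x y.
Proof. by rewrite /rip ipZl; case: (ip x y) => u v /=; rewrite mul0r subr0. Qed.

Lemma ripZr (a : R) x y : rip x (a%:C *: y) = a * rip x y.
Proof. by rewrite ripC ripZl ripC. Qed.

Lemma ripDr x y z : rip z (x + y) = rip z x + rip z y.
Proof. by rewrite ripC ripDl ripC (ripC y). Qed.

Lemma ripNr x y : rip x (- y) = - rip x y.
Proof. by rewrite ripC ripNl ripC. Qed.

Lemma rip_suml (I : Type) (s : seq I) (F : I -> H) y :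
  rip (\sum_(i <- s) F i) y = \sum_(i <- s) rip (F i) y.
Proof. by rewrite /rip ip_suml raddf_sum. Qed.

Lemma rnormD_sqr x y :
  rnorm (x + y) ^+ 2 = rnorm x ^+ 2 + 2 * rip x y + rnorm y ^+ 2.
Proof. by rewrite -!ripxx ripDl !ripDr (ripC y x); ring. Qed.

Lemma rnormB_sqr x y :
  rnorm (x - y) ^+ 2 = rnorm x ^+ 2 - 2 * rip x y + rnorm y ^+ 2.
Proof. by rewrite rnormD_sqr ripNr rnormN; ring. Qed.

(** Expanding the squared norm of [|y| x - |x| y] gives [2 |x| |y| (|x| |y| - rip x y) >= 0]. *)
Lemma rip_le x y : rip x y <= rnorm x * rnorm y.
Proof.
have [x0|x0] := eqVneq (rnorm x) 0.
  by rewrite (rnorm_eq0 x0) /rip ip0l rnorm0 mul0r.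
have [y0|y0] := eqVneq (rnorm y) 0.
  by rewrite (rnorm_eq0 y0) /rip ip0r rnorm0 mulr0.
have xy0 : 0 < rnorm x * rnorm y.
  by rewrite mulr_gt0// lt_def ?x0 ?y0 rnorm_ge0.
have := sqr_ge0 (rnorm ((rnorm y)%:C *: x - (rnorm x)%:C *: y)).
rewrite rnormB_sqr ripZl ripZr !rnormZr !ger0_norm ?rnorm_ge0// => h.
rewrite -(ler_pM2l xy0); nra.
Qed.

Lemma ip_le x y : rnorm (ip x y) <= rnorm x * rnorm y.
Proof.
have [->|n0] := eqVneq (rnorm (ip x y)) 0.
  by rewrite mulr_ge0 ?rnorm_ge0.
have n1 : 0 < rnorm (ip x y) by rewrite lt_def n0 rnorm_ge0.
rewrite -(ler_pM2l n1).
(* Scaling [y] by [ip x y] makes the inner product real and non-negative, which reduces the complex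
   case to [rip_le]. *)
have -> : rnorm (ip x y) * rnorm (ip x y) = rip x (ip x y *: y).
  by rewrite /rip ipZr [in RHS]mulrC rnorm_sqr /= expr2.
by apply: le_trans (rip_le _ _) _; rewrite rnormZ mulrCA.
Qed.

End Hilbert.

(** * Linear maps given as bare functions *)

Section LinearMaps.
Variables (R : realType) (U V : hilbertType R) (T : U -> V).
Hypothesis linT : linear T.

Lemma linear_map0 : T 0 = 0.
Proof.
by have := linT (-1) 0 0; rewrite scaleN1r oppr0 addr0 scaleN1r addNr.
Qed.

Lemma linear_mapD x y : T (x + y) = T x + T y.
Proof. by have := linT 1 x y; rewrite !scale1r. Qed.

Lemma linear_mapZ c x : T (c *: x) = c *: T x.
Proof. by have := linT c x 0; rewrite !addr0 linear_map0 addr0. Qed.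

Lemma linear_mapN x : T (- x) = - T x.
Proof. by rewrite -scaleN1r linear_mapZ scaleN1r. Qed.

Lemma linear_mapB x y : T (x - y) = T x - T y.
Proof. by rewrite linear_mapD linear_mapN. Qed.

Lemma linear_map_sum (I : Type) (s : seq I) (F : I -> U) :
  T (\sum_(i <- s) F i) = \sum_(i <- s) T (F i).
Proof.
by elim/big_rec2: _ => [|i b a _ <-]; rewrite ?linear_map0 ?linear_mapD.
Qed.

End LinearMaps.

Definition opbound (R : realType) (U V : hilbertType R) (c : R) (T : U -> V) :=
  forall x, rnorm (T x) <= c * rnorm x.

(** * Orthonormal bases and Hilbert-Schmidt sums *)

Section OrthonormalBasis.
Variables (R : realType) (U : hilbertType R).
Implicit Types (S : set U) (F : seq U) (x y e : U).

(** A maximal orthonormal set, given by Zorn's lemma, is complete: a nonzero vector orthogonal to it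
    could be normalized and added. Existence ensures that the [xget] in [hs_norm] does pick a
    basis. *)
Lemma orthonormal_basis_exists : exists S : set U, orthonormal_basis S.
Proof.
pose P S := (forall e, S e -> ip e e = 1) /\
  (forall e f, S e -> S f -> e <> f -> ip e f = 0).
have [|S [[S1 S0] Smax]] := @Zorn_bigcup U P.
  move=> C CP Ctot; split=> [e [X CX Xe]|e f [X CX Xe] [Y CY Yf] ef].
    exact: (CP _ CX).1.
  have [XY|YX] := Ctot _ _ CX CY.
    by apply: (CP _ CY).2 => //; exact: XY.
  by apply: (CP _ CX).2 => //; exact: YX.
exists S; split => // x hx; apply: contrapT => x0.
have nx0 : rnorm x != 0 by apply/eqP => /rnorm_eq0.
pose u := ((rnorm x)^-1)%:C *: x.
have uu : ip u u = 1.
  rewrite ipxx rnormZr ger0_norm ?invr_ge0 ?rnorm_ge0//.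
  by rewrite mulVf// expr1n.
have ue e : S e -> ip u e = 0 by move=> /hx h; rewrite ipZl h mulr0.
apply: (Smax (S `|` [set u])).
  split; first by move=> e Se; left.
  move=> /(_ u (or_intror erefl)) /ue; rewrite uu => /eqP.
  by rewrite oner_eq0.
split=> [e [|->//]|e f [Se|->] [Sf|->] ef //]; first exact: S1.
- exact: S0.
- exact/ip_eq0C/ue.
- exact: ue.
Qed.

Definition proj F x : U := \sum_(e <- F) ip x e *: e.

Variable S : set U.
Hypothesis hS : orthonormal_basis S.

Definition finsub F := uniq F /\ forall e, e \in F -> S e.

Lemma ip_proj F x e : finsub F -> e \in F -> ip (proj F x) e = ip x e.
Proof.
move=> [uF FS] eF; rewrite ip_suml (bigD1_seq e)//= big1_seq ?addr0.
  by rewrite ipZl (let: And3 h _ _ := hS in h) ?mulr1//; exact: FS.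
move=> f /andP[fe fF]; rewrite ipZl (let: And3 _ h _ := hS in h f e) ?mulr0//.
- exact: FS.
- exact: FS.
- exact/eqP.
Qed.

Lemma ip_proj_perp F (G : seq U) x y : finsub F -> {subset G <= F} ->
  ip (x - proj F x) (proj G y) = 0.
Proof.
move=> hF GF; rewrite ip_sumr big1_seq// => e /andP[_ eG].
by rewrite ipZr ipBl ip_proj ?subrr ?mulr0//; exact: GF.
Qed.

Lemma proj_pythagoras F (G : seq U) x : finsub F -> {subset G <= F} ->
  rnorm (x - proj G x) ^+ 2 =
  rnorm (x - proj F x) ^+ 2 + rnorm (proj F x - proj G x) ^+ 2.
Proof.
move=> hF GF; rewrite -[x - proj G x](subrKA (proj F x)).
by rewrite [in LHS]rnormD_sqr /rip ipBr !ip_proj_perp// subrr mulr0 addr0.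
Qed.

Lemma proj_le F (G : seq U) x : finsub F -> {subset G <= F} ->
  rnorm (x - proj F x) <= rnorm (x - proj G x).
Proof.
move=> hF GF; rewrite -ler_sqr ?nnegrE ?rnorm_ge0// (proj_pythagoras x hF GF).
by rewrite lerDl sqr_ge0.
Qed.

Definition fincup (F G : seq U) := undup (F ++ G).

Lemma finsub_cup F G : finsub F -> finsub G -> finsub (fincup F G).
Proof.
move=> [_ h] [_ k]; split; first exact: undup_uniq.
by move=> e; rewrite mem_undup mem_cat => /orP[/h|/k].
Qed.

Lemma fincupl F G : {subset F <= fincup F G}.
Proof. by move=> e eF; rewrite mem_undup mem_cat eF. Qed.

Lemma fincupr F G : {subset G <= fincup F G}.
Proof. by move=> e eF; rewrite mem_undup mem_cat eF orbT. Qed.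

(* Nearly distance-minimizing finite families give a Cauchy sequence of
   projections of x, whose limit differs from x by a vector orthogonal to S. *)
Lemma proj_dense x (eps : R) : 0 < eps ->
  exists2 F, finsub F & rnorm (x - proj F x) < eps.
Proof.
pose D := [set rnorm (x - proj F x) ^+ 2 | F in [set F | finsub F]].
have D0 : D (rnorm (x - proj [::] x) ^+ 2) by exists [::].
have hD : has_inf D.
  split; first by eexists; exact: D0.
  by exists 0 => _ [F _ <-]; exact: sqr_ge0.
pose d := inf D.
have near n : {F | finsub F /\ rnorm (x - proj F x) ^+ 2 < d + n.+1%:R^-1}.
  apply: cid; have n0 : (0 : R) < n.+1%:R^-1 by rewrite invr_gt0.
  by have [_ [F hF <-]] := inf_adherent n0 hD; exists F.
pose F n := sval (near n).
have hF n : finsub (F n) by have [] := svalP (near n).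
have dF n : rnorm (x - proj (F n) x) ^+ 2 < d + n.+1%:R^-1.
  by have [] := svalP (near n).
have dle G : finsub G -> d <= rnorm (x - proj G x) ^+ 2.
  by move=> hG; apply: ge_inf; [case: hD|exists G].
(* [proj G x] is still at squared distance at least [d] from [x], so by Pythagoras the new part has
   squared norm at most the excess of [F n] over [d]. *)
have step n G : finsub G -> {subset F n <= G} ->
    rnorm (proj G x - proj (F n) x) ^+ 2 < n.+1%:R^-1.
  move=> hG FG; have := dF n; rewrite (proj_pythagoras x hG FG) => h.
  by rewrite -(ltrD2l d); apply: le_lt_trans h; rewrite lerD2r dle.
have small (e : R) : 0 < e -> exists N, forall n, (N <= n)%N ->
    n.+1%:R^-1 < e :> R.
  move=> e0; exists (Num.bound e^-1) => n hn; rewrite invf_plt ?posrE//.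
  by rewrite (lt_le_trans (archi_boundP _)) ?invr_ge0 ?(ltW e0)// ler_nat leqW.
have stepS (e : R) n G : 0 < e -> n.+1%:R^-1 < e ^+ 2 -> finsub G ->
    {subset F n <= G} -> rnorm (proj G x - proj (F n) x) < e.
  move=> e0 ne hG FG; rewrite -ltr_sqr ?nnegrE ?rnorm_ge0 ?ltW//.
  exact: lt_trans (step _ _ hG FG) ne.
have [p hp] : exists p, forall e : R, 0 < e -> exists N, forall n, (N <= n)%N ->
    rnorm (proj (F n) x - p) < e.
  apply: complete_rnorm => e e0.
  have e2 : 0 < e / 2 by rewrite divr_gt0.
  have [N hN] := small ((e / 2) ^+ 2) (exprn_gt0 _ e2).
  exists N => m n Nm Nn; apply: le_lt_trans (ler_rdist _ (proj (fincup (F m) (F n)) x) _) _.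
  have := stepS _ _ _ e2 (hN _ Nm) (finsub_cup (hF m) (hF n)) (@fincupl _ _).
  have := stepS _ _ _ e2 (hN _ Nn) (finsub_cup (hF m) (hF n)) (@fincupr _ _).
  by rewrite [rnorm (proj (F m) x - _)]rdistC => h1 h2; lra.
have xp : x = p.
  apply/subr0_eq; apply: (let: And3 _ _ h := hS in h) => e Se.
  apply: (@rnorm_eq0 _ R[i]); apply: (@le_eps0 _ _ 2); first exact: rnorm_ge0.
  move=> eps1 e0.
  have [N1 hN1] := small (eps1 ^+ 2) (exprn_gt0 _ e0).
  have [N2 hN2] := hp _ e0.
  pose n := maxn N1 N2.
  have Se' : finsub [:: e] by split=> // f; rewrite inE => /eqP->.
  have ee : ip e e = 1 by apply: (let: And3 h _ _ := hS in h).
  have e1 : rnorm e = 1.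
    by apply/eqP; rewrite -sqrp_eq1 ?rnorm_ge0//; have := ipxx e; rewrite ee => -[<-].
  (* With [e] added to [F n], the projection of [x] has the same inner product with [e] as [x]. Two
     small differences remain, hence the factor 2 above. *)
  have -> : ip (x - p) e =
      ip (proj (fincup (F n) [:: e]) x - proj (F n) x) e + ip (proj (F n) x - p) e.
    rewrite -ipDl addrA subrK !ipBl ip_proj//; last by apply: fincupr; rewrite inE.
    exact: finsub_cup.
  apply: le_trans (ler_rnormD _ _) _; rewrite mulr_natr mulr2n lerD//.
    apply: le_trans (ip_le _ _) _; rewrite e1 mulr1; apply/ltW/stepS => //.
    - by apply: hN1; rewrite leq_maxl.
    - exact: finsub_cup.
    - exact: fincupl.
  by apply: le_trans (ip_le _ _) _; rewrite e1 mulr1; apply/ltW/hN2; rewrite leq_maxr.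
move=> eps0; have [N hN] := hp _ eps0; exists (F N) => //.
by rewrite {1}xp rdistC; apply: hN.
Qed.

Lemma proj_dense_seq (s : seq U) (eps : R) : 0 < eps ->
  exists2 F, finsub F & forall x, x \in s -> rnorm (x - proj F x) < eps.
Proof.
move=> eps0; elim: s => [|y s [F hF hs]]; first by exists [::].
have [G hG hy] := proj_dense y eps0.
exists (fincup G F); first exact: finsub_cup.
move=> x; rewrite inE => /orP[/eqP->|/hs h].
  by apply: le_lt_trans hy; apply: proj_le; [exact: finsub_cup|exact: fincupl].
by apply: le_lt_trans h; apply: proj_le; [exact: finsub_cup|exact: fincupr].
Qed.

(* For P e = \sum_i <e, f_i> f_i one has 0 <= \sum_(e in F) |T e - T (P e)|^2; as F
   exhausts the basis the cross term and the last square tend to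
   \sum_i |T f_i|^2 and \sum_i |f_i|^2 |T f_i|^2. *)
Lemma hilbert_schmidt_sum_le (V : hilbertType R) (T : U -> V) (M b : R)
    (I : finType) (f : I -> U) :
  linear T -> 0 <= M -> opbound M T ->
  (forall F, finsub F -> \sum_(e <- F) rnorm (T e) ^+ 2 <= b) ->
  (forall i, rnorm (f i) <= 1) -> (forall i j, i != j -> ip (f i) (f j) = 0) ->
  \sum_i rnorm (T (f i)) ^+ 2 <= b.
Proof.
move=> linT M0 TM Tb f1 f0.
pose N := \sum_i rnorm (T (f i)) ^+ 2.
pose n : R := #|I|%:R.
have TfM i : rnorm (T (f i)) <= M.
  by apply: le_trans (TM _) _; rewrite -[leRHS]mulr1 ler_wpM2l.
(* The cross term, which occurs twice, is off by at most [n M^2 eps], the last square by at most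
   [n^2 M^2 eps]. *)
apply: (@le_eps _ _ _ (2 * (n * M ^+ 2) + n * (n * M ^+ 2))) => eps eps0.
have [F hF hs] := proj_dense_seq [seq f i | i <- enum I] eps0.
have {}hs i : rnorm (f i - proj F (f i)) <= eps.
  by apply/ltW/hs/map_f; rewrite mem_enum.
pose P e := \sum_i ip e (f i) *: f i.
have cross : \sum_(e <- F) rip (T e) (T (P e)) =
    \sum_i rip (T (proj F (f i))) (T (f i)).
  rewrite /rip -!raddf_sum; congr complex.Re.
  under eq_bigr do rewrite linear_map_sum// ip_sumr.
  rewrite exchange_big; apply: eq_bigr => i _.
  rewrite linear_map_sum// ip_suml; apply: eq_bigr => e _.
  by rewrite !linear_mapZ// ipZr ipZl -ip_conj.
have square : \sum_(e <- F) rnorm (T (P e)) ^+ 2 =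
    \sum_i \sum_j complex.Re (ip (proj F (f j)) (f i) * ip (T (f i)) (T (f j))).
  under eq_bigr do rewrite -ripxx.
  under [RHS]eq_bigr do rewrite -raddf_sum.
  rewrite /rip -!raddf_sum; congr complex.Re.
  under eq_bigr do rewrite linear_map_sum// ip_suml.
  rewrite exchange_big; apply: eq_bigr => i _.
  under eq_bigr do rewrite ip_sumr.
  rewrite exchange_big; apply: eq_bigr => j _.
  rewrite ip_suml mulr_suml; apply: eq_bigr => e _.
  by rewrite !linear_mapZ// ipZl ipZr ipZl -ip_conj; ring.
have crossN : N - n * M ^+ 2 * eps <= \sum_(e <- F) rip (T e) (T (P e)).
  rewrite cross /N lerBlDr /n -sum1_card natr_sum !mulr_suml -big_split /=.
  apply: ler_sum => i _.
  rewrite -ripxx -lerBlDl -ripNl -ripDl -linear_mapB//.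
  apply: le_trans (rip_le _ _) _; rewrite mul1r expr2 -mulrA (mulrC M).
  apply: ler_pM; rewrite ?rnorm_ge0//; apply: le_trans (TM _) _.
  by rewrite ler_wpM2l.
have squareN : \sum_(e <- F) rnorm (T (P e)) ^+ 2 <= N + n * (n * M ^+ 2) * eps.
  rewrite square /N {1}/n -sum1_card natr_sum !mulr_suml -big_split /=.
  apply: ler_sum => i _; rewrite mul1r /n -sum1_card natr_sum !mulr_suml.
  (* A Kronecker delta spreads the diagonal over a double sum, so that the comparison is entry by
     entry. *)
  rewrite -lerBlDl [X in _ - X](_ : _ = \sum_j (i == j)%:R * rnorm (T (f i)) ^+ 2); last first.
    rewrite (bigD1 i)//= eqxx mul1r big1 ?addr0// => j ij.
    by rewrite eq_sym (negPf ij) mul0r.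
  rewrite -sumrB; apply: ler_sum => j _.
  have -> : ip (proj F (f j)) (f i) = ip (proj F (f j) - f j) (f i) + ip (f j) (f i).
    by rewrite ipBl subrK.
  rewrite mulrDl raddfD /= -addrA mul1r -[leRHS]addr0; apply: lerD.
    apply: le_trans (ler_norm _) _; apply: le_trans (Re_le_rnorm _) _.
    rewrite rnormM [leRHS]mulrC; apply: ler_pM; rewrite ?rnorm_ge0//.
      apply: le_trans (ip_le _ _) _; rewrite rdistC -[eps]mulr1.
      by apply: ler_pM; rewrite ?rnorm_ge0.
    by apply: le_trans (ip_le _ _) _; rewrite expr2; apply: ler_pM; rewrite ?rnorm_ge0.
  have [<-|ij] := eqVneq i j; last by rewrite f0 1?eq_sym// mul0r mul0r subr0.
  rewrite mul1r !ipxx -rmorphM /= subr_le0 ler_piMl ?sqr_ge0//.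
  by rewrite expr_le1 ?rnorm_ge0.
have : 0 <= \sum_(e <- F) rnorm (T e - T (P e)) ^+ 2.
  by apply: sumr_ge0 => e _; exact: sqr_ge0.
under eq_bigr do rewrite rnormB_sqr.
rewrite big_split /= sumrB -mulr_sumr => h.
by rewrite -/N; move: (Tb _ hF) => k; clearbody N n; nra.
Qed.

End OrthonormalBasis.

(** * Projection-valued measures *)

Section ProjectionValuedMeasure.
Variables (R : realType) (V : hilbertType R) (E : set R -> V -> V).
Hypothesis hE : is_projection_valued_measure E.
Implicit Types (D A B : set R) (x y : V).

Lemma pvm_linear D : measurable D -> linear (E D).
Proof. by case: hE => h _ _ /h [[]]. Qed.

Lemma pvm_idem D x : measurable D -> E D (E D x) = E D x.
Proof. by case: hE => h _ _ /h [_ /(congr1 (@^~ x))]. Qed.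

Lemma pvm_ip D x y : measurable D -> ip (E D x) y = ip x (E D y).
Proof. by case: hE => h _ _ /h []. Qed.

Lemma pvm_rip D x y : measurable D -> rip (E D x) y = rip x (E D y).
Proof. by move=> mD; rewrite /rip pvm_ip. Qed.

Lemma pvm_norm D x : measurable D -> rnorm (E D x) ^+ 2 = rip (E D x) x.
Proof. by move=> mD; rewrite -ripxx -pvm_rip ?pvm_idem. Qed.

Lemma pvm_norm_le D x : measurable D -> rnorm (E D x) <= rnorm x.
Proof.
move=> mD; have [->|n0] := eqVneq (rnorm (E D x)) 0; first exact: rnorm_ge0.
have n1 : 0 < rnorm (E D x) by rewrite lt_def n0 rnorm_ge0.
by rewrite -(ler_pM2l n1) -expr2 pvm_norm// rip_le.
Qed.

(** Countable additivity on the constant sequence of empty sets makes a series with all terms equal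
    to [E set0 x] converge. *)
Lemma pvm_set0 x : E set0 x = 0.
Proof.
have [_ _ /(_ (fun=> set0) (fun=> measurable0)) hs] := hE.
have t0 : trivIset setT (fun _ : nat => set0 : set R).
  by apply/trivIsetP => *; rewrite set0I.
have /cvg_rnorm hx := hs t0 x.
apply: rnorm_eq0; apply: (@le_eps0 _ _ 2); first exact: rnorm_ge0.
move=> e e0; have [N hN] := hx e e0.
have := hN N (leqnn N); have := hN N.+1 (leqnSn N).
rewrite big_nat_recr//=; set s := \sum_(0 <= k < N) _; set l := E (\bigcup_n _) x => h1 h2.
rewrite (_ : E set0 x = (s + E set0 x - l) - (s - l)); last first.
  by rewrite opprB addrA subrK addrAC subrr add0r.
apply: le_trans (ler_rnormB _ _) _; lra.
Qed.

Lemma pvm_bigcup n (D : 'I_n -> set R) x :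
  (forall k, measurable (D k)) -> trivIset setT D ->
  E (\bigcup_k D k) x = \sum_k E (D k) x.
Proof.
(* The axiom is about sequences of sets: the family is continued by [set0], on which [E]
   vanishes. *)
move=> mD tD; pose F (k : nat) : set R := oapp D set0 (insub k).
have FD (i : 'I_n) : F i = D i by rewrite /F valK.
have F0 k : (n <= k)%N -> F k = set0 by move=> nk; rewrite /F insubF// ltnNge nk.
have mF k : measurable (F k) by rewrite /F; case: insubP => [i|] *; [exact: mD|exact: measurable0].
have tF : trivIset setT F.
  apply/trivIsetP => i j _ _ ij; rewrite /F.
  case: insubP => [i' _ ii|_]; last by rewrite set0I.
  case: insubP => [j' _ jj|_]; last by rewrite setI0.
  have /trivIsetP := tD; apply => //; apply: contra ij => /eqP ij.
  by rewrite -ii -jj ij.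
have [_ _ /(_ F mF tF x)/cvg_rnorm hx] := hE.
have <- : \bigcup_k F k = \bigcup_k D k.
  apply/seteqP; split=> [r [k _]|r [k _ Dr]].
    by rewrite /F; case: insubP => // i _ _ Dr; exists i.
  by exists k => //; rewrite FD.
apply/subr0_eq/rnorm_eq0; apply: (@le_eps0 _ _ 1); first exact: rnorm_ge0.
move=> e e0; have [N hN] := hx e e0.
have := hN (maxn N n) (leq_maxl _ _).
have tail : \sum_(n <= k < maxn N n) E (F k) x = 0.
  by rewrite big_nat big1// => k /andP[nk _]; rewrite F0// pvm_set0.
rewrite (@big_cat_nat _ _ _ n) ?leq_maxr//= tail addr0.
have -> : \sum_(0 <= k < n) E (F k) x = \sum_k E (D k) x.
  by rewrite big_mkord; apply: eq_bigr => i _; rewrite FD.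
by rewrite rdistC mulr1 => /ltW.
Qed.

Lemma pvm_setU A B x : measurable A -> measurable B -> A `&` B = set0 ->
  E (A `|` B) x = E A x + E B x.
Proof.
move=> mA mB AB; pose D (i : 'I_2) := if i == ord0 then A else B.
have -> : A `|` B = \bigcup_k D k.
  apply/seteqP; split=> [r [Ar|Br]|r [k _]].
  - by exists ord0.
  - by exists ord_max.
  - by rewrite /D; case: ifP => _ h; [left|right].
rewrite pvm_bigcup ?big_ord_recr ?big_ord0 /= ?add0r//.
- by move=> k; rewrite /D; case: ifP.
- apply/trivIsetP => i j _ _; rewrite /D.
  have [i0|i0] := eqVneq i ord0; have [j0|j0] := eqVneq j ord0; rewrite ?i0 ?j0//.
    by rewrite setIC.
  by case: i j i0 j0 => [[|[|]]//= ?] [[|[|]]//= ?]; rewrite -!val_eqE.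
Qed.

(** With [y = E B x], additivity gives [|E A y|^2 + |y|^2 = rip (E (A U B) y) y <= |y|^2]. *)
Lemma pvm_disjoint A B x : measurable A -> measurable B -> A `&` B = set0 ->
  E A (E B x) = 0.
Proof.
move=> mA mB AB; apply: rnorm_eq0; apply/eqP; rewrite -sqrf_eq0.
apply/eqP/le_anti/andP; split; last exact: sqr_ge0.
have mAB : measurable (A `|` B) by exact: measurableU.
have : rip (E (A `|` B) (E B x)) (E B x) <= rip (E B x) (E B x).
  rewrite ripxx; apply: le_trans (rip_le _ _) _.
  by rewrite expr2 ler_wpM2r ?rnorm_ge0 ?pvm_norm_le.
by rewrite pvm_setU// ripDl pvm_idem// -pvm_norm//; lra.
Qed.

Lemma pvm_subset A B x : measurable A -> measurable B -> A `<=` B ->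
  E B (E A x) = E A x.
Proof.
move=> mA mB AB; have mBA : measurable (B `\` A) by exact: measurableD.
have -> : B = A `|` (B `\` A) by rewrite setDUK.
have dAB : A `&` (B `\` A) = set0 by rewrite setDIK.
by rewrite pvm_setU// pvm_idem// pvm_disjoint ?addr0// setIC.
Qed.

Lemma pvm_ip_disjoint A B x y : measurable A -> measurable B ->
  A `&` B = set0 -> ip (E A x) (E B y) = 0.
Proof. by move=> mA mB AB; rewrite pvm_ip// pvm_disjoint// ip0r. Qed.

(** * The share of the Hilbert-Schmidt norm carried by a Borel set *)

Section SquaredNorm.
Variables (U : hilbertType R) (B : V -> U) (B' : U -> V) (b : R).
Hypotheses (linB : linear B) (adjB : is_adjoint B B').
Hypothesis hsB : forall (I : finType) (f : I -> V),
  (forall i, rnorm (f i) <= 1) -> (forall i j, i != j -> ip (f i) (f j) = 0) ->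
  \sum_i rnorm (B (f i)) ^+ 2 <= b.

(** Finite families in the range of [E A] spare the choice of a basis of that range. Being
    orthogonal in the unit ball instead of orthonormal, they may contain zero vectors. *)
Definition hs_sums (A : set R) : set R :=
  [set r | exists (I : finType) (f : I -> V),
    [/\ forall i, rnorm (f i) <= 1, forall i j, i != j -> ip (f i) (f j) = 0,
        forall i, E A (f i) = f i & r = \sum_i rnorm (B (f i)) ^+ 2]].

(* the squared Hilbert-Schmidt norm of B E(A) *)
Definition hs_sqr (A : set R) : R := sup (hs_sums A).

Lemma hs_sums_has_sup A : has_sup (hs_sums A).
Proof.
split; last by exists b => _ [I [f [f1 f0 _ ->]]]; exact: hsB.
by exists 0; exists ('I_0 : finType), (fun=> 0); split=> [[]|[]|[]|]//; rewrite big_ord0.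
Qed.

Lemma hs_sqr_ub A (I : finType) (f : I -> V) :
  (forall i, rnorm (f i) <= 1) -> (forall i j, i != j -> ip (f i) (f j) = 0) ->
  (forall i, E A (f i) = f i) ->
  \sum_i rnorm (B (f i)) ^+ 2 <= hs_sqr A.
Proof.
move=> f1 f0 fA; apply: sup_ubound; first by case: (hs_sums_has_sup A).
by exists I, f.
Qed.

Lemma hs_sqr_le A : hs_sqr A <= b.
Proof.
apply: ge_sup; first by case: (hs_sums_has_sup A).
by move=> _ [I [f [f1 f0 _ ->]]]; exact: hsB.
Qed.

Lemma hs_sqr_ge0 A : 0 <= hs_sqr A.
Proof.
have := @hs_sqr_ub A ('I_0 : finType) (fun=> 0); rewrite big_ord0.
by apply; case.
Qed.

(** Near-optimal families for [A] and for [C] together form an orthogonal family, as the ranges of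
    [E A] and [E C] are orthogonal. *)
Lemma hs_sqr_add A C : measurable A -> measurable C -> A `&` C = set0 ->
  hs_sqr A + hs_sqr C <= hs_sqr (A `|` C).
Proof.
move=> mA mC sAC; have mAC : measurable (A `|` C) by exact: measurableU.
apply/ler_addgt0Pr => e e0; have e2 : 0 < e / 2 by rewrite divr_gt0.
have [_ [I [f [f1 f0 fA ->]]] hf] := sup_adherent e2 (hs_sums_has_sup A).
have [_ [J [g [g1 g0 gC ->]]] hg] := sup_adherent e2 (hs_sums_has_sup C).
pose h (k : I + J) := match k with inl i => f i | inr j => g j end.
have fg i j : ip (f i) (g j) = 0 by rewrite -fA -gC pvm_ip_disjoint.
have : \sum_k rnorm (B (h k)) ^+ 2 <= hs_sqr (A `|` C).
  apply: hs_sqr_ub; first by case.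
  - case=> [i|j] [i'|j'] ij //=.
    + by rewrite f0//; apply: contra ij => /eqP->.
    + exact/ip_eq0C.
    + by rewrite g0//; apply: contra ij => /eqP->.
  - case=> [i|j] /=; first by rewrite -fA pvm_subset.
    by rewrite -gC pvm_subset.
rewrite big_sumType /= => hh; rewrite /hs_sqr in hh *.
by move: hf hg hh; set s1 := \sum_i _; set s2 := \sum_i _; lra.
Qed.

Lemma hs_sqr_setD A C : measurable A -> measurable C -> A `<=` C ->
  hs_sqr A + hs_sqr (C `\` A) <= hs_sqr C.
Proof.
move=> mA mC sAC; have -> : hs_sqr C = hs_sqr (A `|` (C `\` A)).
  by rewrite setDUK.
by apply: hs_sqr_add; rewrite ?setDIK//; exact: measurableD.
Qed.

(* With v the sum below and v_i = E(D_i) v, |v|^2 = \sum_i <y_i, B v_i>, which by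
   AM-GM is at most (|v|^2 + c^2 \sum_i |B v_i|^2 / |v_i|^2) / 2. *)
Lemma rnorm_pvm_sum (I : finType) (D : I -> set R) (A : set R) (y : I -> U) (c : R) :
  (forall i, measurable (D i)) -> measurable A -> (forall i, D i `<=` A) ->
  (forall i j, i != j -> D i `&` D j = set0) ->
  0 <= c -> (forall i, rnorm (y i) <= c) ->
  rnorm (\sum_i E (D i) (B' (y i))) ^+ 2 <= c ^+ 2 * hs_sqr A.
Proof.
move=> mD mA DA D0 c0 yc; set v := \sum_i _.
pose w i := E (D i) v.
have wE i : w i = E (D i) (B' (y i)).
  rewrite /w /v (linear_map_sum (pvm_linear (mD i))) (bigD1 i)//= pvm_idem//.
  rewrite big1 ?addr0// => j ji; rewrite pvm_disjoint//.
  by apply: D0; rewrite eq_sym.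
have vw : rnorm v ^+ 2 = \sum_i rnorm (w i) ^+ 2.
  rewrite -{1}ripxx {1}/v rip_suml; apply: eq_bigr => i _.
  by rewrite pvm_norm// -/(w i) wE.
have vB : rnorm v ^+ 2 = \sum_i rip (y i) (B (w i)).
  rewrite -{1}ripxx {1}/v rip_suml; apply: eq_bigr => i _.
  by rewrite pvm_rip// -/(w i) ripC [RHS]ripC /rip adjB.
(* The inverse of 0 is 0, so [f i] vanishes with [w i]; this is why [hs_sums] admits zero
   vectors. *)
pose f i := ((rnorm (w i))^-1)%:C *: w i.
have wfE i : w i = (rnorm (w i))%:C *: f i.
  rewrite /f scalerA -rmorphM /=; have [w0|w0] := eqVneq (rnorm (w i)) 0.
    by rewrite w0 mul0r scale0r (rnorm_eq0 w0).
  by rewrite divff// scale1r.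
have hf : \sum_i rnorm (B (f i)) ^+ 2 <= hs_sqr A.
  apply: hs_sqr_ub => [i|i j ij|i].
  - rewrite rnormZr ger0_norm ?invr_ge0 ?rnorm_ge0//.
    have [->|w0] := eqVneq (rnorm (w i)) 0; first by rewrite mulr0.
    by rewrite mulVf.
  - by rewrite /f ipZl ipZr pvm_ip_disjoint ?mulr0// D0.
  - by rewrite /f (linear_mapZ (pvm_linear mA)) pvm_subset.
have : 2 * rnorm v ^+ 2 <=
    rnorm v ^+ 2 + c ^+ 2 * \sum_i rnorm (B (f i)) ^+ 2.
  rewrite {1}vB {1}vw !mulr_sumr -big_split /=; apply: ler_sum => i _.
  rewrite {1}wfE (linear_mapZ linB) ripZr.
  have := rip_le (y i) (B (f i)); have := yc i.
  have := rnorm_ge0 (B (f i)); have := rnorm_ge0 (w i); have := rnorm_ge0 (y i).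
  set p := rip _ _; set Y := rnorm (y i); set W := rnorm (w i).
  set F := rnorm (B (f i)) => Y0 W0 F0 Yc pYF.
  have pcF : p <= c * F by apply: le_trans pYF _; rewrite ler_wpM2r.
  have WpcF : W * p <= W * (c * F) by rewrite ler_wpM2l.
  by have := sqr_ge0 (W - c * F); nra.
have : c ^+ 2 * \sum_i rnorm (B (f i)) ^+ 2 <= c ^+ 2 * hs_sqr A.
  by rewrite ler_wpM2l ?sqr_ge0.
by move=> h1 h2; lra.
Qed.

End SquaredNorm.

End ProjectionValuedMeasure.

(** * Real bounds for operators *)

Section OperatorNorm.
Variables (R : realType) (U V : hilbertType R).
Implicit Types (T : U -> V) (c e : R).

Lemma opbound_unit T c : linear T ->
  (forall x, rnorm x <= 1 -> rnorm (T x) <= c) -> opbound c T.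
Proof.
move=> linT h x; have [x0|x0] := eqVneq (rnorm x) 0.
  by rewrite x0 mulr0 (rnorm_eq0 x0) linear_map0// rnorm0.
have x1 : 0 < rnorm x by rewrite lt_def x0 rnorm_ge0.
have := h (((rnorm x)^-1)%:C *: x).
rewrite linear_mapZ// !rnormZr ger0_norm ?invr_ge0 ?rnorm_ge0// mulVf// lexx.
by move=> /(_ isT); rewrite mulrC ler_pdivrMr.
Qed.

Lemma opnorm_le T c : linear T -> (opnorm T <= c%:E)%E -> opbound c T.
Proof.
move=> linT h; apply: opbound_unit => // x x1; rewrite -lee_fin.
by apply: le_trans h; apply: ereal_sup_ubound; exists x.
Qed.

Lemma opbound_opnorm T c : 0 <= c -> opbound c T -> (opnorm T <= c%:E)%E.
Proof.
move=> c0 h; apply: ge_ereal_sup => _ [x /= x1 <-]; rewrite lee_fin.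
by apply: le_trans (h x) _; rewrite ler_piMr.
Qed.

Lemma opbound_opnorm_lt T c e : 0 <= c -> c < e -> opbound c T ->
  (opnorm T < e%:E)%E.
Proof.
move=> c0 ce h; apply: le_lt_trans (opbound_opnorm c0 h) _.
by rewrite lte_fin.
Qed.

Lemma opbound_le T c e : c <= e -> opbound c T -> opbound e T.
Proof.
by move=> ce h x; apply: le_trans (h x) _; rewrite ler_wpM2r ?rnorm_ge0.
Qed.

Lemma bounded_operatorP T :
  bounded_operator T <-> linear T /\ exists2 c : R, 0 <= c & opbound c T.
Proof.
split=> [[linT cT]|[linT [c c0 Tc]]]; split=> //.
  have /nbhs_rnorm [e e0 he] : nbhs 0 (T @^-1` [set y | rnorm y < 1]).
    apply: cT; apply/nbhs_rnorm; exists 1 => // y.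
    by rewrite linear_map0// sub0r rnormN.
  exists (2 / e); first by rewrite divr_ge0// ltW.
  apply: opbound_unit => // x x1.
  have e2 : 0 < e / 2 by rewrite divr_gt0.
  have : rnorm (T ((e / 2)%:C *: x)) < 1.
    apply: he; rewrite sub0r rnormN rnormZr ger0_norm ?(ltW e2)//.
    by apply: le_lt_trans (ler_wpM2l (ltW e2) x1) _; lra.
  rewrite linear_mapZ// rnormZr ger0_norm ?(ltW e2)// => /ltW h.
  by rewrite ler_pdivlMr//; nra.
move=> x A /nbhs_rnorm [e e0 hA]; apply/nbhs_rnorm.
have c1 : 0 < c + 1 by rewrite ltr_wpDl.
exists (e / (c + 1)); first by rewrite divr_gt0.
move=> y; rewrite ltr_pdivlMr// => h; apply: hA; rewrite -linear_mapB//.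
apply: le_lt_trans (Tc _) _; apply: le_lt_trans h.
by rewrite mulrC ler_wpM2l ?rnorm_ge0// lerDl.
Qed.

End OperatorNorm.

(** * Limits of operators and the contraction principle *)

Section OperatorLimits.
Variables (R : realType) (U V : hilbertType R).

(** The limit is built pointwise from the completeness of [V]; the uniform Cauchy estimate survives
    when one of its two indices tends to infinity. *)
Lemma operator_complete (X : nat -> U -> V) :
  (forall n, bounded_operator (X n)) ->
  (forall e : R, 0 < e -> exists N, forall m n, (N <= m)%N -> (N <= n)%N ->
     opbound e (fun x => X m x - X n x)) ->
  exists2 Y, bounded_operator Y & forall e : R, 0 < e ->
    exists N, forall n, (N <= n)%N -> opbound e (fun x => X n x - Y x).
Proof.
move=> bX hX.
have pt x : {y | forall e : R, 0 < e -> exists N, forall n, (N <= n)%N ->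
    rnorm (X n x - y) < e}.
  apply/cid/complete_rnorm => e e0.
  have x1 : 0 < rnorm x + 1 by rewrite ltr_wpDl ?rnorm_ge0.
  have [N hN] := hX (e / (rnorm x + 1)) (divr_gt0 e0 x1).
  exists N => m n Nm Nn; apply: le_lt_trans (hN _ _ Nm Nn x) _.
  by rewrite mulrAC ltr_pdivrMr// ltr_pM2l// ltrDl.
pose Y x := sval (pt x).
have hY x : forall e : R, 0 < e -> exists N, forall n, (N <= n)%N ->
    rnorm (X n x - Y x) < e by exact: (svalP (pt x)).
have XY (e : R) : 0 < e -> exists N, forall n, (N <= n)%N ->
    opbound e (fun x => X n x - Y x).
  move=> e0; have [N hN] := hX e e0; exists N => n Nn x.
  apply: (@le_eps _ _ _ 1) => e' e'0; have [M hM] := hY x e' e'0.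
  apply: le_trans (ler_rdist _ (X (maxn N M) x) _) _; apply: lerD.
    by apply: hN => //; rewrite leq_maxl.
  by rewrite mulr1; apply/ltW/hM; rewrite leq_maxr.
exists Y => //; apply/bounded_operatorP; split; last first.
  have [N /(_ N (leqnn N)) hN] := XY 1 ltr01.
  have /bounded_operatorP [_ [c c0 hc]] := bX N.
  exists (c + 1); first by rewrite addr_ge0.
  move=> x; rewrite -[Y x](subrKC (X N x)) mulrDl.
  by apply: le_trans (ler_rnormD _ _) _; rewrite rdistC lerD ?hc ?hN.
move=> c x y; apply/subr0_eq/rnorm_eq0.
apply: (@le_eps0 _ _ (1 + (rnorm c + 1))); first exact: rnorm_ge0.
move=> e e0.
have [N1 h1] := hY (c *: x + y) e e0; have [N2 h2] := hY x e e0.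
have [N3 h3] := hY y e e0; pose n := maxn N1 (maxn N2 N3).
have [/(_ c x y) Xl _] := bX n.
have -> : Y (c *: x + y) - (c *: Y x + Y y) =
    (Y (c *: x + y) - X n (c *: x + y)) + (c *: (X n x - Y x) + (X n y - Y y)).
  by rewrite scalerBr Xl [X in _ = _ + X]addrACA -opprD addrA subrK.
apply: le_trans (ler_rnormD _ _) _; rewrite mulrDr mulr1 lerD//.
  by rewrite rdistC; apply/ltW/h1; rewrite leq_maxl.
apply: le_trans (ler_rnormD _ _) _; rewrite mulrDr mulr1 lerD//.
  rewrite rnormZ mulrC ler_wpM2r ?rnorm_ge0//; apply/ltW/h2.
  by rewrite /n maxnCA leq_maxl.
by apply/ltW/h3; rewrite /n maxnA leq_maxr.
Qed.

Lemma geometric_small (q c e : R) : 0 <= q < 1 -> 0 <= c -> 0 < e ->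
  exists N, forall n, (N <= n)%N -> q ^+ n * c < e.
Proof.
move=> /andP[q0 q1] c0 e0; have c1 : 0 < c + 1 by rewrite ltr_wpDl.
have /cvg_expr : `|q| < 1 by rewrite ger0_norm.
move=> /cvgrPdist_lt /(_ (e / (c + 1)) (divr_gt0 e0 c1)) [N _ hN].
exists N => n /hN /=; rewrite sub0r normrN ger0_norm ?exprn_ge0//.
rewrite ltr_pdivlMr// => h; apply: le_lt_trans h.
by rewrite ler_wpM2l ?exprn_ge0// lerDl.
Qed.

(** Banach's fixed-point theorem on an operator ball, with a bound [c] on the difference in the role
    of the distance. It serves both the Neumann series and the equation itself. *)
Lemma operator_fixpoint (Phi : (U -> V) -> U -> V) (r q : R) :
  0 <= r -> 0 <= q < 1 ->
  (forall X, bounded_operator X -> opbound r X ->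
     bounded_operator (Phi X) /\ opbound r (Phi X)) ->
  (forall X Y c, bounded_operator X -> opbound r X ->
     bounded_operator Y -> opbound r Y -> 0 <= c ->
     opbound c (fun x => X x - Y x) ->
     opbound (q * c) (fun x => Phi X x - Phi Y x)) ->
  exists X, [/\ bounded_operator X, opbound r X & Phi X = X].
Proof.
move=> r0 q01 Phir Phiq; have /andP[q0 q1] := q01.
pose X n := iter n Phi (fun=> 0).
have hX n : bounded_operator (X n) /\ opbound r (X n).
  elim: n => [|n [h1 h2]]; last exact: Phir.
  have b0 : opbound r (X 0%N).
    by move=> x; rewrite rnorm0 mulr_ge0 ?rnorm_ge0.
  split=> //; apply/bounded_operatorP; split; last by exists r.
  by move=> c x y; rewrite /X /= scaler0 addr0.
have r20 : 0 <= 2 * r by rewrite mulr_ge0.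
(* Two elements of the ball differ by at most [2 r], and each application of [Phi] gains a factor
   [q]. *)
have step n m : opbound (q ^+ n * (2 * r)) (fun x => X (n + m)%N x - X n x).
  elim: n => [|n IH].
    move=> x; rewrite expr0 mul1r; apply: le_trans (ler_rnormB _ _) _.
    by rewrite mulr_natl mulr2n mulrDl lerD// (hX _).2.
  rewrite exprS -mulrA; apply: Phiq; rewrite ?mulr_ge0 ?exprn_ge0//.
  - exact: (hX _).1.
  - exact: (hX _).2.
  - exact: (hX _).1.
  - exact: (hX _).2.
have [e0|Y bY hY] := operator_complete (fun n => (hX n).1).
  move=> e0pos; have [N hN] := geometric_small q01 r20 e0pos.
  have le m n : (N <= n)%N -> opbound e0 (fun x => X (n + m)%N x - X n x).
    by move=> /hN /ltW h; apply: opbound_le h (step n m).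
  exists N => m n Nm Nn; have [mn|/ltnW nm] := leqP n m.
    by rewrite -(subnKC mn); exact: le.
  by move=> x; rewrite rdistC -(subnKC nm); exact: le.
have Yr : opbound r Y.
  move=> x; apply: (@le_eps _ _ _ (rnorm x)) => e e0.
  have [N /(_ N (leqnn N) x) hN] := hY e e0.
  rewrite -[Y x](subrKC (X N x)); apply: le_trans (ler_rnormD _ _) _.
  by rewrite rdistC lerD// (hX _).2.
exists Y; split=> //; apply/funext => x; apply/subr0_eq/rnorm_eq0.
apply: (@le_eps0 _ _ (2 * rnorm x)); first exact: rnorm_ge0.
move=> e e0; have [N hN] := hY e e0.
apply: le_trans (ler_rdist _ (X N.+1 x) _) _.
rewrite mulrCA mulr_natl mulr2n lerD//; last by apply: hN; rewrite leqW.
rewrite rdistC; apply: le_trans (Phiq _ _ e _ _ _ _ _ _ x) _ => //.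
- exact: (hX _).1.
- exact: (hX _).2.
- exact: ltW.
- exact: hN.
by rewrite ler_wpM2r ?rnorm_ge0// ler_piMl ?(ltW e0)// ltW.
Qed.

Lemma operator_fixpoint_uniq (Phi : (U -> V) -> U -> V) (r q : R) X Y :
  0 <= r -> 0 <= q < 1 ->
  (forall X Y c, bounded_operator X -> opbound r X ->
     bounded_operator Y -> opbound r Y -> 0 <= c ->
     opbound c (fun x => X x - Y x) ->
     opbound (q * c) (fun x => Phi X x - Phi Y x)) ->
  bounded_operator X -> opbound r X -> Phi X = X ->
  bounded_operator Y -> opbound r Y -> Phi Y = Y -> X = Y.
Proof.
move=> r0 q01 Phiq bX Xr PX bY Yr PY; have /andP[q0 q1] := q01.
have r20 : 0 <= 2 * r by rewrite mulr_ge0.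
have XY n : opbound (q ^+ n * (2 * r)) (fun x => X x - Y x).
  elim: n => [|n IH].
    move=> x; rewrite expr0 mul1r; apply: le_trans (ler_rnormB _ _) _.
    by rewrite mulr_natl mulr2n mulrDl lerD.
  rewrite exprS -mulrA -PX -PY.
  by apply: Phiq => //; rewrite mulr_ge0 ?exprn_ge0.
apply/funext => x; apply/subr0_eq/rnorm_eq0.
apply: (@le_eps0 _ _ (rnorm x)); first exact: rnorm_ge0.
move=> e e0; have [N hN] := geometric_small q01 r20 e0.
by apply: opbound_le (XY N) x; exact/ltW/hN.
Qed.

End OperatorLimits.

(** * Resolvents and their perturbation *)

Section Resolvents.
Variables (R : realType) (U : hilbertType R).
Implicit Types (A Y : operator U) (K T : U -> U) (z : R[i]).

Lemma is_resolvent_uniq Y z T T' :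
  is_resolvent Y z T -> is_resolvent Y z T' -> T = T'.
Proof.
move=> [_ _ hT] [_ hT' _]; apply/funext => x.
by have [dx] := hT' x; have := hT _ dx; move=> + e; rewrite e => ->.
Qed.

Lemma resolventP Y z : resolvent_set Y z -> is_resolvent Y z (resolvent Y z).
Proof. by move=> h; rewrite /resolvent; apply: xgetPex. Qed.

Lemma resolventE Y z T : is_resolvent Y z T -> resolvent Y z = T.
Proof.
move=> h; have h' : resolvent_set Y z by exists T.
exact: is_resolvent_uniq (resolventP h') h.
Qed.

(** Write [x] as [(A + K2 - z2) T2 x] and [T2 x] as [T1 (A + K1 - z1) T2 x]. This form covers a
    change of the spectral parameter as well as a change of the perturbation. *)
Lemma resolvent_identity A K1 K2 z1 z2 T1 T2 x :
  is_resolvent (add_operator A K1) z1 T1 ->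
  is_resolvent (add_operator A K2) z2 T2 ->
  T2 x - T1 x = T1 (K1 (T2 x) - K2 (T2 x) + (z2 - z1) *: T2 x).
Proof.
move=> [[lin1 _] _ h1] [_ h2 _]; have [dx e2] := h2 x.
rewrite -{1}(h1 _ dx) -linear_mapB//; congr (T1 _).
rewrite -[X in _ - X]e2 /= scalerBl; move: (A _) (K1 _) (K2 _) (z1 *: _) (z2 *: _).
move=> a k1 k2 u1 u2.
rewrite opprB [u2 - _]addrC addrACA [- u1 + _]addrC opprD.
by rewrite [a + k1 + _]addrACA subrr add0r.
Qed.

(** Moving the spectral parameter is a perturbation by a scalar, so the Neumann series also shows
    that the resolvent set is open. *)
Lemma is_resolvent_shift A z h T :
  is_resolvent (add_operator A (fun x => - (h *: x))) z T ->
  is_resolvent A (z + h) T.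
Proof.
have e x : A x - (z + h) *: x = A x - h *: x - z *: x.
  by rewrite scalerDl opprD addrA addrAC.
move=> [bT h1 h2]; split=> // x; first by rewrite e; exact: h1.
by move=> /h2; rewrite e.
Qed.

(* The Neumann series, in the form of the equation S + K T S = 1 for S. *)
Lemma resolvent_perturbation A z T K (tau kappa : R) :
  linear_operator A -> is_resolvent A z T -> linear K ->
  0 <= tau -> 0 <= kappa -> opbound tau T -> opbound kappa K ->
  tau * kappa < 1 ->
  exists2 T', is_resolvent (add_operator A K) z T' &
    opbound (tau / (1 - tau * kappa)) T'.
Proof.
move=> [dA0 linA] rT linK tau0 kappa0 Ttau Kkappa tk1.
have [[linT cT] hT1 hT2] := rT.
set q := tau * kappa in tk1 *.
have q0 : 0 <= q by rewrite mulr_ge0.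
have q1 : 0 < 1 - q by rewrite subr_gt0.
have KT x : rnorm (K (T x)) <= q * rnorm x.
  apply: le_trans (Kkappa _) _; rewrite /q mulrC -mulrA mulrCA.
  by rewrite [leLHS]mulrC ler_wpM2l.
have linKT : linear (K \o T) by move=> c x y /=; rewrite linT linK.
have r0 : 0 <= (1 - q)^-1 by rewrite invr_ge0 ltW.
pose Phi (S : U -> U) x := x - K (T (S x)).
(* The radius [r] solves [1 + q r = r], so [Phi] maps the ball into itself. *)
have [S [bS Sr /(congr1 (fun f => f _)) hS]] : exists S, [/\ bounded_operator S,
    opbound (1 - q)^-1 S & Phi S = S].
  apply: (@operator_fixpoint _ _ _ _ _ q) => //; first by rewrite q0 -subr_gt0.
    move=> X /bounded_operatorP [linX _] Xr.
    have PX : opbound (1 - q)^-1 (Phi X).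
      move=> x; apply: le_trans (ler_rnormB _ _) _.
      apply: le_trans (lerD (lexx _) (KT _)) _.
      apply: le_trans (lerD (lexx _) (ler_wpM2l q0 (Xr _))) _.
      rewrite le_eqVlt; apply/orP; left; apply/eqP; field.
      by rewrite lt0r_neq0.
    split=> //; apply/bounded_operatorP; split; last by exists (1 - q)^-1.
    by move=> c x y; rewrite /Phi linX linT linK scalerBr opprD addrACA.
  move=> X Y c /bounded_operatorP [linX _] Xr /bounded_operatorP [linY _] Yr c0 XY x.
  have -> : Phi X x - Phi Y x = - K (T (X x - Y x)).
    rewrite /Phi (linear_mapB linT) (linear_mapB linK); move: (K _) (K _) => k' k.
    by rewrite [RHS]opprB [in LHS]opprB [k' - x]addrC addrACA subrr add0r addrC.
  rewrite rnormN; apply: le_trans (KT _) _.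
  by rewrite -mulrA ler_wpM2l.
have {}hS x : S x + K (T (S x)) = x by rewrite -{1}hS subrK.
pose T' x := T (S x).
have T'dom x : dom A (T' x) by have [] := hT1 (S x).
have T'eq x : A (T' x) + K (T' x) - z *: T' x = x.
  by rewrite addrAC (hT1 (S x)).2 hS.
(* A kernel vector satisfies [w = T (- K w)], of norm at most [q |w|]. Injectivity turns the right
   inverse [T'] into a left inverse. *)
have inj w : dom A w -> A w + K w - z *: w = 0 -> w = 0.
  move=> dw; rewrite addrAC => /eqP; rewrite addr_eq0 => /eqP e.
  have := hT2 _ dw; rewrite e => ew.
  have : rnorm w <= q * rnorm w.
    rewrite -{1}ew; apply: le_trans (Ttau _) _.
    by rewrite rnormN -mulrA ler_wpM2l.
  have := rnorm_ge0 w => w0 w1; apply: rnorm_eq0; nra.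
have linT' : linear T'.
  by case/bounded_operatorP: bS => linS _ c x y; rewrite /T' linS linT.
have T'b : opbound (tau / (1 - q)) T'.
  by move=> x; apply: le_trans (Ttau _) _; rewrite -mulrA ler_wpM2l.
exists T' => //; split=> //.
- apply/bounded_operatorP; split=> //; exists (tau / (1 - q)) => //.
  by rewrite divr_ge0// ltW.
- by move=> x; split; [exact: T'dom|exact: T'eq].
- move=> x dx; apply/subr0_eq/inj.
    rewrite addrC -scaleN1r; exact: (linA _ _ _ dx (T'dom _)).1.
  have d1 := T'dom (A x + K x - z *: x).
  rewrite -[X in A X](_ : (-1) *: x + T' (A x + K x - z *: x) = _); last first.
    by rewrite scaleN1r addrC.
  rewrite (linA _ _ _ dx d1).2 (linear_mapB linK) scalerBr scaleN1r.
  have := T'eq (A x + K x - z *: x).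
  set a := A (T' _); set k := K (T' _); set u := z *: T' _.
  move: (A x) (K x) (z *: x) => a' k' u' e.
  suff -> : - a' + a + (k - k') - (u - u') = (a + k - u) - (a' + k' - u').
    by rewrite e subrr.
  rewrite [- a' + a]addrC [a - a' + _]addrACA -opprD !opprB.
  by rewrite [u' - (a' + k')]addrC [RHS]addrACA [- u + u']addrC.
Qed.

End Resolvents.

(** * Spectrum and resolvent norm of self-adjoint operators *)

Section SelfAdjoint.
Variables (R : realType) (U : hilbertType R).
Implicit Types (A : operator U) (T : U -> U).

Lemma resolvent_set_open A (mu : R) : linear_operator A ->
  resolvent_set A mu%:C ->
  exists2 e : R, 0 < e & forall nu : R, `|mu - nu| < e -> resolvent_set A nu%:C.
Proof.
move=> linA [T rT]; have [bT _ _] := rT.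
have /bounded_operatorP [_ [c c0 Tc]] := bT.
have c1 : 0 < c + 1 by rewrite ltr_wpDl.
(* The denominator is [c + 1] because the bound [c] of [T] may be 0. *)
exists (c + 1)^-1 => [|nu hnu]; first by rewrite invr_gt0.
have [|||T' rT' _] := @resolvent_perturbation _ _ A mu%:C T
    (fun x => - ((nu - mu)%:C *: x)) c `|nu - mu| linA rT _ c0 (normr_ge0 _) Tc.
- by move=> a x y; rewrite scalerDr opprD scalerN !scalerA [_ * a]mulrC.
- by move=> x; rewrite rnormN rnormZr.
- rewrite distrC; have [->|h0] := eqVneq `|mu - nu| 0; first by rewrite mulr0.
  apply: (@lt_le_trans _ _ ((c + 1) * `|mu - nu|)).
    by rewrite ltr_pM2r ?ltrDl// lt_def h0 normr_ge0.
  by rewrite mulrC -ler_pdivlMr// div1r ltW.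
exists T'; rewrite -[nu](subrKC mu) rmorphD /=.
exact: is_resolvent_shift rT'.
Qed.

(** The spectrum is closed. Its intersections with intervals must be Borel sets to be cut into
    partitions. *)
Lemma measurable_real_spectrum A : linear_operator A ->
  measurable (real_spectrum A).
Proof.
move=> linA; have oN : open (~` real_spectrum A).
  rewrite openE => mu /= /contrapT /(resolvent_set_open linA) [e e0 he].
  apply/nbhs_ballP; exists e => // nu; rewrite -ball_normE /= => /he h hn.
  exact: hn.
rewrite -[real_spectrum A]setCK; apply: measurableC.
exact: measurable_realfun.open_measurable.
Qed.

Lemma resolvent_sym A (mu : R) T : self_adjoint A -> is_resolvent A mu%:C T ->
  is_adjoint T T.
Proof.
move=> [_ _ hA] [_ hT _] x y.
have [dx ex] := hT x; have [dy ey] := hT y.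
have key : ip (A (T x)) (T y) = ip (T x) (A (T y)).
  exact: ((hA (T y) (A (T y))).2 (conj dy erefl)).
rewrite -[in LHS]ey -[in RHS]ex ipBr ipBl ipZr ipZl key.
by congr (_ - _ * _); apply/eqP; rewrite eq_complex /= oppr0 !eqxx.
Qed.

(* Let M = |T| and suppose M > 1/d. As mu + 1/M and mu - 1/M are in the resolvent
   set, 1 - T/M and 1 + T/M are bounded below, hence so is 1 - T^2/M^2. But
   |x - T^2 x/M^2|^2 <= |x|^2 - |T x|^2/M^2 since T is symmetric, so that
   |T x| <= rho M |x| for some rho < 1. *)
Lemma self_adjoint_resolvent_bound A (mu d : R) T : self_adjoint A -> 0 < d ->
  is_resolvent A mu%:C T ->
  (forall nu : R, `|nu - mu| < d -> resolvent_set A nu%:C) ->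
  opbound d^-1 T.
Proof.
move=> sA d0 rT hnu; have [bT hT _] := rT.
have /bounded_operatorP [linT [c c0 Tc]] := bT.
pose N := [set rnorm (T x) | x in [set x | rnorm x <= 1]].
have N0 : N 0 by exists 0; rewrite /= ?linear_map0// rnorm0.
have supN : has_sup N.
  split; first by exists 0.
  exists c => _ [x /= x1 <-]; apply: le_trans (Tc x) _.
  by rewrite ler_piMr.
pose M := sup N.
have TM : opbound M T.
  apply: opbound_unit => // x x1; apply: sup_ubound; first by case: supN.
  by exists x.
have [Md|dM] := leP M d^-1; first exact: opbound_le TM.
exfalso; have M0 : 0 < M by apply: lt_trans dM; rewrite invr_gt0.
have Md : M^-1 < d by rewrite invf_plt ?posrE.
have below (s : R) : `|s| = M^-1 ->
    exists2 C, 0 < C & forall x, rnorm x <= C * rnorm (x - s%:C *: T x).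
  move=> sM; have [S rS] : resolvent_set A (mu + s)%:C.
    by apply: hnu; rewrite addrAC subrr add0r sM.
  have [bS _ hS] := rS; have /bounded_operatorP [_ [k k0 Sk]] := bS.
  exists (1 + M^-1 * k) => [|x]; first by rewrite ltr_pwDl// mulr_ge0// invr_ge0 ltW.
  have [dx ex] := hT x.
  (* [(A - mu - s) (T x) = x - s (T x)], so [T x], and with it [x], is controlled by
     [x - s (T x)]. *)
  have Tx : T x = S (x - s%:C *: T x).
    by rewrite -{1}(hS _ dx) rmorphD /= scalerDl opprD addrA ex.
  rewrite -{1}[x](subrK (s%:C *: T x)); apply: le_trans (ler_rnormD _ _) _.
  rewrite mulrDl mul1r lerD2l rnormZr sM -mulrA ler_wpM2l ?invr_ge0 ?(ltW M0)//.
  by rewrite {1}Tx.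
have [|C1 C10 h1] := below M^-1; first by rewrite ger0_norm// invr_ge0 ltW.
have [|C2 C20 h2] := below (- M^-1); first by rewrite normrN ger0_norm// invr_ge0 ltW.
pose s := M^-1; have s0 : 0 < s by rewrite invr_gt0.
(* The added 1 gives [C >= 1], so that [1 - C^-2] has a square root [rho] below 1. *)
pose C := C1 * C2 + 1; have C0 : 0 < C by rewrite ltr_pwDr// mulr_ge0// ltW.
have h x : rnorm x <= C * rnorm (x - (s ^+ 2)%:C *: T (T x)).
  apply: le_trans (h1 x) _; apply: le_trans (ler_wpM2l (ltW C10) (h2 _)) _.
  have -> : x - (M^-1)%:C *: T x - (- M^-1)%:C *: T (x - (M^-1)%:C *: T x) =
      x - (s ^+ 2)%:C *: T (T x).
    rewrite (linear_mapB linT) (linear_mapZ linT) scalerBr scalerA -rmorphM /= mulNr -expr2.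
    by rewrite !rmorphN /= !scaleNr opprK opprD opprK subrKA.
  rewrite mulrA ler_wpM2r ?rnorm_ge0// lerDl//.
have symT := resolvent_sym sA rT.
have hsq x : rnorm x ^+ 2 <= C ^+ 2 * (rnorm x ^+ 2 - s ^+ 2 * rnorm (T x) ^+ 2).
  have : rnorm x ^+ 2 <= (C * rnorm (x - (s ^+ 2)%:C *: T (T x))) ^+ 2.
    by rewrite ler_sqr ?nnegrE ?h// ?mulr_ge0 ?rnorm_ge0// ltW.
  rewrite exprMn => /le_trans; apply; rewrite ler_wpM2l ?sqr_ge0//.
  rewrite rnormB_sqr ripZr {1}/rip -symT -/(rip _ _) ripxx rnormZr.
  rewrite ger0_norm ?sqr_ge0// exprMn.
  have : s ^+ 2 * rnorm (T (T x)) ^+ 2 <= rnorm (T x) ^+ 2.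
    rewrite -exprMn ler_sqr ?nnegrE ?mulr_ge0 ?rnorm_ge0 ?(ltW s0)//.
    by rewrite mulrC ler_pdivrMr// mulrC.
  move=> k; have : s ^+ 2 * (s ^+ 2 * rnorm (T (T x)) ^+ 2) <= s ^+ 2 * rnorm (T x) ^+ 2.
    by rewrite ler_wpM2l ?sqr_ge0.
  nra.
have rho2 : 0 <= 1 - (C ^- 2) < 1.
  have C1' : 1 <= C by rewrite lerDr mulr_ge0// ltW.
  by rewrite subr_ge0 invf_le1 ?exprn_gt0// exprn_ege1//= ltrBlDr ltrDl invr_gt0 exprn_gt0.
pose rho := Num.sqrt (1 - C ^- 2).
have rho1 : rho < 1 by rewrite -sqrtr1 ltr_sqrt//; case/andP: rho2.
have : M <= M * rho.
  apply: ge_sup; first by exists 0.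
  move=> _ [x /= x1 <-].
  rewrite -ler_sqr ?nnegrE ?rnorm_ge0 ?mulr_ge0 ?sqrtr_ge0 ?(ltW M0)//.
  rewrite exprMn sqr_sqrtr; last by case/andP: rho2.
  have x2 : rnorm x ^+ 2 <= 1 by rewrite expr_le1 ?rnorm_ge0.
  have := hsq x; rewrite -ler_pdivrMl ?exprn_gt0// => k.
  rewrite -ler_pdivrMl ?exprn_gt0// -exprVn -/s.
  apply: le_trans (_ : (1 - C ^- 2) * rnorm x ^+ 2 <= _); first by nra.
  by rewrite ler_piMr//; case/andP: rho2.
by rewrite leNgt gtr_pMr// rho1.
Qed.

End SelfAdjoint.

(** * Partitions into small Borel sets *)

Section TaggedPartitions.
Variable R : realType.
Implicit Types (S C : set R).

Lemma tagged_partition_mem S n (D : 'I_n -> set R) t k r :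
  tagged_partition S D t -> D k r -> S r.
Proof. by move=> [_ _ <- _] Dr; exists k. Qed.

Lemma tagged_partition_inj S n (D : 'I_n -> set R) t k l r :
  tagged_partition S D t -> D k r -> D l r -> k = l.
Proof. by move=> [_ tD _ _] Dk Dl; apply: tD => //; exists r. Qed.

Lemma tagged_partition_extend S C c n (D : 'I_n -> set R) t eta :
  tagged_partition S D t -> mesh_lt D eta ->
  measurable C -> S `&` C = set0 -> C c ->
  (forall r s, C r -> C s -> `|r - s| < eta) ->
  exists (D' : 'I_n.+1 -> set R) t',
    tagged_partition (S `|` C) D' t' /\ mesh_lt D' eta.
Proof.
move=> [mD tD DS Dt] De mC SC Cc Ce.
pose D' (k : 'I_n.+1) := oapp D C (unlift ord_max k).
pose t' (k : 'I_n.+1) := oapp t c (unlift ord_max k).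
have DC k r : D k r -> C r -> False.
  move=> Dr Cr; have : (S `&` C) r by split=> //; rewrite -DS; exists k.
  by rewrite SC.
exists D', t'; split; last first.
  by rewrite /D' => k r s; case: (unliftP ord_max k) => [j|] _ /=; [exact: De|exact: Ce].
split.
- by rewrite /D' => k; case: (unliftP ord_max k) => [j|] _ /=; [exact: mD|exact: mC].
- rewrite /D' => k l _ _ [r []].
  case: (unliftP ord_max k) => [i|] -> /=; case: (unliftP ord_max l) => [j|] -> //=.
  + by move=> Di Dj; congr lift; apply: tD => //; exists r.
  + by move=> Di Dj; case: (DC _ _ Di Dj).
  + by move=> Di Dj; case: (DC _ _ Dj Di).
- rewrite /D'; apply/seteqP; split=> [r [k _]|r [|Cr]].
  + case: (unliftP ord_max k) => [j|] _ /= h; last by right.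
    by left; rewrite -DS; exists j.
  + by rewrite -DS => -[k _ Dr]; exists (lift ord_max k) => //; rewrite liftK.
  + by exists ord_max => //; rewrite unlift_none.
- by rewrite /D' /t' => k; case: (unliftP ord_max k) => [j|] _ /=.
Qed.

(** Without fine partitions the limit in [is_integral_on] would constrain nothing. They come from
    half-open strips of width [eta], added from the left. *)
Lemma fine_tagged_partition S (a b eta : R) : measurable S ->
  S `<=` `[a, b[ -> 0 < eta ->
  exists n (D : 'I_n -> set R) t, tagged_partition S D t /\ mesh_lt D eta.
Proof.
move=> mS Sab eta0.
have step m : exists n (D : 'I_n -> set R) t,
    tagged_partition (S `&` `]-oo, (a + m%:R * eta)[) D t /\ mesh_lt D eta.
  elim: m => [|m [n [D [t [hD De]]]]].
    have D0 : 'I_0 -> set R by case.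
    have t0 : 'I_0 -> R by case.
    exists 0%N, D0, t0; split; last by case.
    split; [by case|by case| |by case].
    apply/seteqP; split=> [r [[]]//|r [/Sab]] /=.
    by rewrite !in_itv /= mul0r addr0 => /andP[h _]; rewrite ltNge h.
  pose C := S `&` `[(a + m%:R * eta), (a + m.+1%:R * eta)[.
  have mC : measurable C by apply: measurableI => //; exact: measurable_itv.
  have e : S `&` `]-oo, (a + m.+1%:R * eta)[ = (S `&` `]-oo, (a + m%:R * eta)[) `|` C.
    rewrite /C -setIUr; congr (S `&` _); apply/seteqP; split=> r /=; rewrite !in_itv /=.
      by move=> ->; rewrite andbT; case: ltP => _; [left|right].
    move=> [h|/andP[]//]; apply: lt_trans h _.
    by rewrite ltrD2l ltr_pM2r// ltr_nat.
  (* A tag has to lie in its cell, so a strip that misses [S] contributes no cell. *)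
  have [C0|/set0P/negP/negPn/eqP C0] := pselect (C !=set0); last first.
    exists n, D, t; rewrite e (_ : C = set0) ?setU0//.
  have [c Cc] := C0.
  have [|r s [_ +] [_ +]|D' [t' h]] := tagged_partition_extend hD De mC _ Cc.
  - rewrite /C setIACA; apply/seteqP; split=> // r [_ []] /=.
    by rewrite !in_itv /= => h /andP[]; rewrite leNgt h.
  - rewrite /= !in_itv /= => /andP[r1 r2] /andP[s1 s2].
    by rewrite -natr1 in r2 s2; rewrite ltr_norml; lra.
  - by exists n.+1, D', t'; rewrite e.
have [n [D [t h]]] := step (Num.bound ((b - a) / eta)).
exists n, D, t; move: h; rewrite (_ : S `&` _ = S)//.
apply/setIidl => r /Sab /=; rewrite !in_itv /= => /andP[ar rb].
have ab := le_trans ar (ltW rb).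
apply: lt_le_trans rb _; rewrite -lerBlDl -ler_pdivrMr//.
apply/ltW/archi_boundP; by rewrite divr_ge0 ?(ltW eta0)// subr_ge0.
Qed.

End TaggedPartitions.

(** * Riemann sums with operator-valued integrands *)

Section RiemannSums.
Variables (R : realType) (U V : hilbertType R) (E : set R -> V -> V).
Hypothesis hE : is_projection_valued_measure E.
Variables (B : V -> U) (B' : U -> V) (b : R).
Hypotheses (linB : linear B) (linB' : linear B') (adjB : is_adjoint B B').
Hypothesis b0 : 0 <= b.
Hypothesis hsB : forall (I : finType) (f : I -> V),
  (forall i, rnorm (f i) <= 1) -> (forall i j, i != j -> ip (f i) (f j) = 0) ->
  \sum_i rnorm (B (f i)) ^+ 2 <= b ^+ 2.
Implicit Types (S : set R) (G : R -> U -> U).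

Definition hs_cut S : R := Num.sqrt (hs_sqr E B S).

Lemma hs_cut_le S : hs_cut S <= b.
Proof.
by rewrite -[b]ger0_norm// -sqrtr_sqr /hs_cut ler_sqrt ?sqr_ge0 ?hs_sqr_le.
Qed.

Lemma hs_cut_set0 : hs_cut set0 = 0.
Proof.
rewrite /hs_cut; apply/eqP; rewrite sqrtr_eq0.
have := hs_sqr_add hE hsB (@measurable0 _ R) (@measurable0 _ R) (setI0 _).
rewrite setU0; lra.
Qed.

Definition riemann_sum n (D : 'I_n -> set R) (t : 'I_n -> R) G (x : U) : V :=
  \sum_(k < n) E (D k) (B' (G (t k) x)).

Lemma rnorm_pvm_sum_sqrt (I : finType) (D : I -> set R) S (y : I -> U) (c : R) :
  (forall i, measurable (D i)) -> measurable S -> (forall i, D i `<=` S) ->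
  (forall i j, i != j -> D i `&` D j = set0) ->
  0 <= c -> (forall i, rnorm (y i) <= c) ->
  rnorm (\sum_i E (D i) (B' (y i))) <= c * hs_cut S.
Proof.
move=> mD mS DS D0 c0 yc.
rewrite -ler_sqr ?nnegrE ?rnorm_ge0 ?mulr_ge0 ?sqrtr_ge0//.
rewrite exprMn sqr_sqrtr; last exact: (hs_sqr_ge0 _ hsB).
exact: (rnorm_pvm_sum hE linB adjB hsB mD mS DS D0 c0 yc).
Qed.

Lemma riemann_sum_bound S n (D : 'I_n -> set R) t G x c :
  measurable S -> tagged_partition S D t -> 0 <= c ->
  (forall k, rnorm (G (t k) x) <= c) ->
  rnorm (riemann_sum D t G x) <= c * hs_cut S.
Proof.
move=> mS [mD tD DS _] c0 Gc; apply: rnorm_pvm_sum_sqrt => //.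
  by move=> k r Dr; rewrite -DS; exists k.
by move=> i j ij; move/trivIsetP : tD; apply.
Qed.

(* Common refinement, plus the part of S' outside S. *)
Lemma riemann_sum_diff S S' n (D' : 'I_n -> set R) t' m (D : 'I_m -> set R) t
    G' G x (c1 c2 : R) :
  measurable S -> measurable S' -> S `<=` S' ->
  tagged_partition S' D' t' -> tagged_partition S D t ->
  0 <= c1 -> 0 <= c2 ->
  (forall k l r, D' k r -> D l r -> rnorm (G' (t' k) x - G (t l) x) <= c1) ->
  (forall k, rnorm (G' (t' k) x) <= c2) ->
  rnorm (riemann_sum D' t' G' x - riemann_sum D t G x) <=
    c1 * hs_cut S + c2 * hs_cut (S' `\` S).
Proof.
move=> mS mS' SS' hD' hD c10 c20 hc1 hc2.
have [mD' tD' DS' _] := hD'; have [mD tD DS _] := hD.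
have mI k l : measurable (D' k `&` D l) by exact: measurableI.
have mO k : measurable (D' k `\` S) by exact: measurableD.
have splitD' k x' : E (D' k) x' =
    \sum_l E (D' k `&` D l) x' + E (D' k `\` S) x'.
  rewrite -(pvm_bigcup hE)//; last first.
    by apply/trivIsetP => i j _ _ ij; rewrite setIACA (trivIsetP.1 tD i j)// setI0.
  rewrite -setI_bigcupr DS -(pvm_setU hE) ?setUIDK//.
  - by rewrite setIC; apply: measurableI.
  - by apply/seteqP; split=> // r [[_ h] []].
have splitD l x' : E (D l) x' = \sum_k E (D' k `&` D l) x'.
  rewrite -(pvm_bigcup hE)//; last first.
    by apply/trivIsetP => i j _ _ ij; rewrite setIACA (trivIsetP.1 tD' i j)// set0I.
  congr (E _ _); rewrite -setI_bigcupl DS' setIidr//.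
  by move=> r Dr; apply: SS'; rewrite -DS; exists l.
(* The hypothesis bounds tag differences only for cells that meet. The default 0 on the other pairs
   is harmless, as [E set0 = 0]. *)
pose y (p : 'I_n * 'I_m) := if pselect (D' p.1 `&` D p.2 !=set0)
  then G' (t' p.1) x - G (t p.2) x else 0.
have -> : riemann_sum D' t' G' x - riemann_sum D t G x =
    \sum_p E (D' p.1 `&` D p.2) (B' (y p)) +
    \sum_k E (D' k `\` S) (B' (G' (t' k) x)).
  rewrite /riemann_sum; under eq_bigr do rewrite splitD'.
  under [X in _ - X]eq_bigr do rewrite splitD.
  rewrite big_split /= [X in _ - X]exchange_big /= addrAC; congr (_ + _).
  rewrite !pair_bigA /= -sumrB; apply: eq_bigr => -[k l] _ /=.
  rewrite /y /=; case: pselect => h /=.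
    by rewrite -(linear_mapB (pvm_linear hE (mI k l))) -(linear_mapB linB').
  have -> : D' k `&` D l = set0 by apply: contrapT => /eqP/set0P.
  by rewrite !(pvm_set0 hE) subrr.
apply: le_trans (ler_rnormD _ _) _; apply: lerD; apply: rnorm_pvm_sum_sqrt => //=.
- by move=> [k l] r /= [_ Dr]; exact: (tagged_partition_mem hD Dr).
- move=> [k l] [k' l'] /= ne; apply/seteqP; split=> // r [[h1 h2] [h3 h4]].
  move/eqP: ne; apply; congr pair.
    exact: tagged_partition_inj hD' h1 h3.
  exact: tagged_partition_inj hD h2 h4.
- move=> [k l]; rewrite /y /=; case: pselect => /= [[r [h1 h2]]|_].
    exact: hc1 h1 h2.
  by rewrite rnorm0.
- exact: measurableD.
- by move=> k r [Dr nS]; split=> //; apply: tagged_partition_mem hD' Dr.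
- move=> i j ij; apply/seteqP; split=> // r [[h1 _] [h2 _]].
  by move/eqP: ij; apply; exact: tagged_partition_inj hD' h1 h2.
Qed.


(** Convertible to the integrand that [is_spectral_integral] passes to [is_integral_on]. *)
Definition integrand G (D : set R) (mu : R) : U -> V := E D \o B' \o G mu.

Lemma riemann_sum_linear S n (D : 'I_n -> set R) t G :
  tagged_partition S D t -> (forall mu, S mu -> linear (G mu)) ->
  linear (riemann_sum D t G).
Proof.
move=> hD linG c x y; have [mD _ _ Dt] := hD.
rewrite /riemann_sum scaler_sumr -big_split; apply: eq_bigr => k _ /=.
rewrite (linG (t k)); last exact: tagged_partition_mem hD (Dt k).
by rewrite linB' (pvm_linear hE (mD k)).
Qed.

Lemma riemann_sum_bounded S n (D : 'I_n -> set R) t G C :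
  measurable S -> tagged_partition S D t -> 0 <= C ->
  (forall mu, S mu -> linear (G mu)) ->
  (forall mu, S mu -> opbound C (G mu)) ->
  bounded_operator (riemann_sum D t G).
Proof.
move=> mS hD C0 linG GC; apply/bounded_operatorP; split.
  exact: riemann_sum_linear hD linG.
exists (C * hs_cut S); first by rewrite mulr_ge0// sqrtr_ge0.
move=> x; rewrite mulrAC; apply: riemann_sum_bound => //.
  by rewrite mulr_ge0// rnorm_ge0.
move=> k; apply: GC; have [_ _ _ Dt] := hD; exact: tagged_partition_mem hD (Dt k).
Qed.

Section Lipschitz.
Variables (sigma : set R) (G : R -> U -> U) (C L : R).
Hypotheses (C0 : 0 <= C) (L0 : 0 <= L).
Hypothesis linG : forall mu, sigma mu -> linear (G mu).
Hypothesis GC : forall mu, sigma mu -> opbound C (G mu).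
Hypothesis GL : forall mu nu, sigma mu -> sigma nu ->
  opbound (L * `|mu - nu|) (fun x => G mu x - G nu x).

(** Cells that meet have tags within [e' + e] of each other. With [S' = S] this yields the Cauchy
    property in the mesh; with vanishing meshes, the size of a tail. *)
Lemma riemann_sum_mesh S S' n (D' : 'I_n -> set R) t' m (D : 'I_m -> set R) t e e' :
  measurable S -> measurable S' -> S `<=` S' -> S' `<=` sigma ->
  tagged_partition S' D' t' -> tagged_partition S D t ->
  mesh_lt D' e' -> mesh_lt D e -> 0 <= e -> 0 <= e' ->
  opbound (L * (e' + e) * b + C * hs_cut (S' `\` S))
    (fun x => riemann_sum D' t' G x - riemann_sum D t G x).
Proof.
move=> mS mS' SS' S's hD' hD De' De e0 e'0 x.
have [_ _ _ Dt'] := hD'; have [_ _ _ Dt] := hD.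
have ee0 : 0 <= e' + e by rewrite addr_ge0.
have s' k : sigma (t' k) by apply: S's; exact: tagged_partition_mem hD' (Dt' k).
have s l : sigma (t l) by apply/S's/SS'; exact: tagged_partition_mem hD (Dt l).
apply: le_trans (riemann_sum_diff (c1 := L * (e' + e) * rnorm x)
  (c2 := C * rnorm x) mS mS' SS' hD' hD _ _ _ _) _.
- by rewrite !mulr_ge0// rnorm_ge0.
- by rewrite mulr_ge0// rnorm_ge0.
- move=> k l r h1 h2; apply: le_trans (GL (s' k) (s l) x) _.
  rewrite ler_wpM2r ?rnorm_ge0// ler_wpM2l//.
  rewrite -(subrKA r) (le_trans (ler_normD _ _))// lerD//.
    exact/ltW/(De' k).
  exact/ltW/(De l).
- by move=> k; apply: GC.
rewrite mulrDl lerD//; last by rewrite mulrAC.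
by rewrite [leRHS]mulrAC ler_wpM2l ?hs_cut_le// !mulr_ge0// rnorm_ge0.
Qed.

Lemma integral_exists S a c' : measurable S -> S `<=` `[a, c'[ -> S `<=` sigma ->
  exists J, is_integral_on (integrand G) S J.
Proof.
move=> mS Sab Ss.
have P k : {X : {n & (('I_n -> set R) * ('I_n -> R))%type} |
    tagged_partition S (projT2 X).1 (projT2 X).2 /\
    mesh_lt (projT2 X).1 k.+1%:R^-1}.
  apply: cid; have k0 : (0 : R) < k.+1%:R^-1 by rewrite invr_gt0.
  have [n [D [t h]]] := fine_tagged_partition mS Sab k0.
  by exists (existT _ n (D, t)).
pose X k := riemann_sum (projT2 (sval (P k))).1 (projT2 (sval (P k))).2 G.
have Lb0 : 0 < L * b + 1 by rewrite ltr_wpDl// mulr_ge0.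
have diff n (D : 'I_n -> set R) t m (D' : 'I_m -> set R) t' e e' :
    tagged_partition S D t -> tagged_partition S D' t' ->
    mesh_lt D e -> mesh_lt D' e' -> 0 < e -> 0 < e' ->
    opbound ((e' + e) * (L * b + 1))
      (fun x => riemann_sum D' t' G x - riemann_sum D t G x).
  move=> hD hD' De De' e0 e'0.
  apply: opbound_le (riemann_sum_mesh mS mS _ Ss hD' hD De' De (ltW e0) (ltW e'0)) => //.
  rewrite setDv hs_cut_set0 mulr0 addr0 mulrAC [leRHS]mulrC.
  by rewrite ler_wpM2r ?lerDl// ltW// addr_gt0.
have inv0 k : (0 : R) < k.+1%:R^-1 by rewrite invr_gt0.
have small (e : R) : 0 < e -> exists N, forall n, (N <= n)%N ->
    n.+1%:R^-1 * (L * b + 1) < e.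
  move=> e0; exists (Num.bound (e / (L * b + 1))^-1) => n hn.
  rewrite -ltr_pdivlMr// invf_plt ?posrE ?divr_gt0//.
  by rewrite (lt_le_trans (archi_boundP _)) ?invr_ge0 ?divr_ge0 ?(ltW e0) ?(ltW Lb0)// ler_nat leqW.
have [k|e e0|J bJ XJ] := @operator_complete _ _ _ X.
- have [h _] := svalP (P k); apply: riemann_sum_bounded mS h C0 _ _ => mu /Ss.
    exact: linG.
  exact: GC.
- have [N hN] := small (e / 2) (divr_gt0 e0 (ltr0Sn _ _)).
  exists N => m n /hN hm /hN hn.
  have [h1 h2] := svalP (P m); have [h3 h4] := svalP (P n).
  apply: opbound_le (diff _ _ _ _ _ _ _ _ h3 h1 h4 h2 (inv0 n) (inv0 m)).
  by rewrite mulrDl [e]splitr lerD// ltW.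
exists J; split=> // eps eps0.
have e4 : 0 < eps / 4 by rewrite divr_gt0.
have [N1 hN1] := small _ e4; have [N2 hN2] := XJ _ e4.
pose N := maxn N1 N2.
exists (eps / 4 / (L * b + 1)); first by rewrite divr_gt0.
move=> n D t hD De.
have [h1 h2] := svalP (P N).
(* The mesh of the given partition, that of the reference partition and the distance of the latter's
   sum to [J] cost [eps / 4] each. *)
apply: (@opbound_opnorm_lt _ _ _ _ (eps / 4 + eps / 4 + eps / 4)); [lra|lra|].
move=> x; apply: le_trans (ler_rdist _ (X N x) _) _; rewrite mulrDl lerD//; last first.
  by apply: hN2; rewrite leq_maxr.
apply: le_trans (diff _ _ _ _ _ _ _ _ h1 hD h2 De (inv0 N) _ x) _.
  by rewrite divr_gt0.
rewrite ler_wpM2r ?rnorm_ge0// mulrDl lerD//.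
  by rewrite divfK ?gt_eqF.
by apply/ltW/hN1; rewrite leq_maxl.
Qed.

(** The cap [eta] on the mesh lets one partition meet several requirements. *)
Lemma integral_approx S J a c' e eta : measurable S -> S `<=` `[a, c'[ ->
  S `<=` sigma -> is_integral_on (integrand G) S J -> 0 < e -> 0 < eta ->
  exists2 eta', 0 < eta' <= eta & forall n (D : 'I_n -> set R) t,
    tagged_partition S D t -> mesh_lt D eta' ->
    opbound e (fun x => riemann_sum D t G x - J x).
Proof.
move=> mS Sab Ss [bJ hJ] e0 eta0; have [eta' eta'0 h] := hJ e e0.
exists (Num.min eta eta'); first by rewrite lt_min eta0 eta'0 ge_min lexx.
move=> n D t hD De; apply: opnorm_le.
  have lin : linear (riemann_sum D t G).
    by apply: riemann_sum_linear hD _ => mu /Ss; exact: linG.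
  by have [linJ _] := bJ => c x y; rewrite lin linJ scalerBr opprD addrACA.
apply/ltW/h => // k r s Dr Ds; apply: lt_le_trans (De k r s Dr Ds) _.
by rewrite ge_min lexx orbT.
Qed.

End Lipschitz.

End RiemannSums.

(** * Integrals over bounded pieces and over the whole spectrum *)

Section SpectralIntegrals.
Variables (R : realType) (U V : hilbertType R) (E : set R -> V -> V).
Hypothesis hE : is_projection_valued_measure E.
Variables (B : V -> U) (B' : U -> V) (b : R).
Hypotheses (linB : linear B) (linB' : linear B') (adjB : is_adjoint B B').
Hypothesis b0 : 0 <= b.
Hypothesis hsB : forall (I : finType) (f : I -> V),
  (forall i, rnorm (f i) <= 1) -> (forall i j, i != j -> ip (f i) (f j) = 0) ->
  \sum_i rnorm (B (f i)) ^+ 2 <= b ^+ 2.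
Implicit Types (S : set R) (G : R -> U -> U).

Lemma linear_sub (T T' : U -> V) : linear T -> linear T' ->
  linear (fun x => T x - T' x).
Proof. by move=> l l' c x y; rewrite l l' scalerBr opprD addrACA. Qed.

(** On a partition fine enough for both integrals, the difference of the Riemann sums is the Riemann
    sum of [G - G'], of norm at most [c b]. *)
Lemma integral_stable S a a' G G' J J' c :
  measurable S -> S `<=` `[a, a'[ -> 0 <= c ->
  (forall mu, S mu -> linear (G mu)) -> (forall mu, S mu -> linear (G' mu)) ->
  (forall mu, S mu -> opbound c (fun x => G mu x - G' mu x)) ->
  is_integral_on (integrand E B' G) S J -> is_integral_on (integrand E B' G') S J' ->
  opbound (c * b) (fun x => J x - J' x).
Proof.
move=> mS Sab c0 linG linG' GG' hJ hJ' x.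
apply: (@le_eps _ _ _ (2 * rnorm x)) => e e0.
have [eta /andP[eta0 _] h] :=
  integral_approx hE linB' linG mS Sab (@subset_refl _ S) hJ e0 ltr01.
have [eta' /andP[eta'0 le'] h'] :=
  integral_approx hE linB' linG' mS Sab (@subset_refl _ S) hJ' e0 eta0.
have [n [D [t [hD De]]]] := fine_tagged_partition mS Sab eta'0.
have De' : mesh_lt D eta by move=> k r s Dr Ds; exact: lt_le_trans (De k r s Dr Ds) le'.
have [_ _ _ Dt] := hD.
have key : rnorm (riemann_sum E B' D t G x - riemann_sum E B' D t G' x) <= c * b * rnorm x.
  have -> : riemann_sum E B' D t G x - riemann_sum E B' D t G' x =
      riemann_sum E B' D t (fun mu x => G mu x - G' mu x) x.
    rewrite /riemann_sum -sumrB; apply: eq_bigr => k _.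
    have [mD _ _ _] := hD.
    by rewrite -(linear_mapB (pvm_linear hE (mD k))) -(linear_mapB linB').
  apply: le_trans (riemann_sum_bound hE linB adjB hsB mS hD (c := c * rnorm x) _ _) _.
  - by rewrite mulr_ge0// rnorm_ge0.
  - by move=> k; apply: GG'; exact: tagged_partition_mem hD (Dt k).
  rewrite mulrAC ler_wpM2r ?rnorm_ge0// ler_wpM2l//.
  exact: hs_cut_le.
apply: le_trans (ler_rdist _ (riemann_sum E B' D t G x) _) _.
apply: le_trans (lerD (lexx _) (ler_rdist _ (riemann_sum E B' D t G' x) _)) _.
rewrite rdistC; have k1 := h _ _ _ hD De' x; have k2 := h' _ _ _ hD De x.
lra.
Qed.

(** As both meshes tend to 0 in [riemann_sum_mesh], only the contribution of [S' \ S] remains. *)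
Lemma integral_tail (sigma : set R) G C L S S' a a' J J' :
  0 <= C -> 0 <= L -> (forall mu, sigma mu -> linear (G mu)) ->
  (forall mu, sigma mu -> opbound C (G mu)) ->
  (forall mu nu, sigma mu -> sigma nu ->
     opbound (L * `|mu - nu|) (fun x => G mu x - G nu x)) ->
  measurable S -> measurable S' -> S `<=` S' -> S' `<=` sigma ->
  S' `<=` `[a, a'[ ->
  is_integral_on (integrand E B' G) S J -> is_integral_on (integrand E B' G) S' J' ->
  opbound (C * hs_cut E B (S' `\` S)) (fun x => J' x - J x).
Proof.
move=> C0 L0 linG GC GL mS mS' SS' S's S'ab hJ hJ' x.
have Sab := subset_trans SS' S'ab; have Ss := subset_trans SS' S's.
apply: (@le_eps _ _ _ (2 * rnorm x + L * 2 * b * rnorm x)) => e e0.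
have [eta /andP[eta0 le] h] := integral_approx hE linB' linG mS Sab Ss hJ e0 e0.
have [eta' /andP[eta'0 le'] h'] :=
  integral_approx hE linB' linG mS' S'ab S's hJ' e0 e0.
have [n [D [t [hD De]]]] := fine_tagged_partition mS Sab eta0.
have [m [D' [t' [hD' De']]]] := fine_tagged_partition mS' S'ab eta'0.
have key := riemann_sum_mesh hE linB linB' adjB b0 hsB C0 L0 GC GL mS mS' SS' S's
  hD' hD De' De (ltW eta0) (ltW eta'0) x.
have k1 := h _ _ _ hD De x; have k2 := h' _ _ _ hD' De' x.
have Lb : L * (eta' + eta) * b * rnorm x <= L * (2 * e) * b * rnorm x.
  rewrite ler_wpM2r ?rnorm_ge0// ler_wpM2r// ler_wpM2l//; lra.
apply: le_trans (ler_rdist _ (riemann_sum E B' D' t' G x) _) _.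
apply: le_trans (lerD (lexx _) (ler_rdist _ (riemann_sum E B' D t G x) _)) _.
rewrite rdistC; move: key k1 k2 Lb.
set n1 := rnorm (_ - _); set n2 := rnorm (_ - _); set n3 := rnorm (_ - _).
by move=> key k1 k2 Lb; nra.
Qed.

Lemma near_infty2 (P : R -> R -> Prop) :
  (\forall a \near -oo & c \near +oo, P a c) <->
  exists M N, forall a c, a < M -> N < c -> P a c.
Proof.
split=> [[[X Y] [/= [M [_ hX]] [N [_ hY]]] h]|[M [N h]]].
  by exists M, N => a c /hX Xa /hY Yc; exact: (h (a, c)).
exists ([set a | a < M], [set c | N < c]) => /=.
  by split; [exists M; split=> //; exact: num_real|exists N; split=> //; exact: num_real].
by move=> [a c] /= [aM Nc]; exact: h.
Qed.

(** It serves three purposes: [G' = 0] bounds an integral, two resolvent families give the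
    contraction estimate, and [c = 0] gives uniqueness of the integral. *)
Lemma spectral_integral_stable (sigma : set R) G G' I I' c :
  measurable sigma -> 0 <= c ->
  (forall mu, sigma mu -> linear (G mu)) -> (forall mu, sigma mu -> linear (G' mu)) ->
  (forall mu, sigma mu -> opbound c (fun x => G mu x - G' mu x)) ->
  linear I -> linear I' ->
  is_spectral_integral E sigma B' G I -> is_spectral_integral E sigma B' G' I' ->
  opbound (c * b) (fun x => I x - I' x).
Proof.
move=> ms c0 linG linG' GG' linI linI' [J hJ JI] [J' hJ' JI'] x.
apply: (@le_eps _ _ _ (2 * rnorm x)) => e e0.
have /near_infty2 [M [N h]] := JI e e0.
have /near_infty2 [M' [N' h']] := JI' e e0.
(* The truncations are known to be integrals only for [a < b]; the caps at 0 force [p < 0 < q]. *)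
pose p := Num.min (Num.min M M') 0 - 1; pose q := Num.max (Num.max N N') 0 + 1.
have [pM pM' p0] : [/\ p < M, p < M' & p < 0].
  have : p < Num.min (Num.min M M') 0 by rewrite ltrBlDr ltrDl.
  by rewrite !lt_min => /andP[/andP[-> ->] ->].
have [Nq Nq' q0] : [/\ N < q, N' < q & 0 < q].
  have : Num.max (Num.max N N') 0 < q by rewrite ltrDl.
  by rewrite !gt_max => /andP[/andP[-> ->] ->].
have pq := lt_trans p0 q0.
have [linJ _] : bounded_operator (J p q) by case: (hJ p q pq).
have [linJ' _] : bounded_operator (J' p q) by case: (hJ' p q pq).
have k1 : opbound e (fun x => J p q x - I x).
  by apply: opnorm_le; [exact: linear_sub|exact/ltW/h].
have k2 : opbound e (fun x => J' p q x - I' x).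
  by apply: opnorm_le; [exact: linear_sub|exact/ltW/h'].
have mS : measurable (sigma `&` `[p, q[) by apply: measurableI => //; exact: measurable_itv.
have key : opbound (c * b) (fun x => J p q x - J' p q x).
  apply: (integral_stable mS (@subIsetr _ _ _) c0 _ _ _ (hJ _ _ pq) (hJ' _ _ pq)).
  - by move=> mu [/linG].
  - by move=> mu [/linG'].
  - by move=> mu [/GG'].
apply: le_trans (ler_rdist _ (J p q x) _) _.
apply: le_trans (lerD (lexx _) (ler_rdist _ (J' p q x) _)) _.
rewrite rdistC; have := key x; have := k1 x; have := k2 x => *.
lra.
Qed.

Lemma spectral_integral0 (sigma : set R) :
  is_spectral_integral E sigma B' (fun _ _ => 0) (fun=> 0).
Proof.
have lin0 : linear (fun _ : U => 0 : V) by move=> c x y; rewrite scaler0 addr0.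
have bd0 c : 0 <= c -> opbound c (fun _ : U => 0 : V).
  by move=> c0 x; rewrite rnorm0 mulr_ge0// rnorm_ge0.
have op0 (T : U -> V) eps : T = (fun=> 0) -> 0 < eps -> (opnorm T < eps%:E)%E.
  by move=> -> eps0; exact: (@opbound_opnorm_lt _ _ _ _ 0 eps _ eps0 (bd0 0 _)).
exists (fun _ _ _ => 0) => [a c _|eps eps0].
  split; first by apply/bounded_operatorP; split=> //; exists 0 => //; exact: bd0.
  move=> eps eps0; exists 1 => // n D t [mD _ _ _] _.
  apply: op0 => //; apply/funext => x; rewrite subr0 big1// => k _ /=.
  by rewrite (linear_map0 linB') (linear_map0 (pvm_linear hE (mD k))).
apply/near_infty2; exists 0, 0 => a c _ _; apply: op0 => //.
by apply/funext => x /=; rewrite subrr.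
Qed.

(* The norm of the integral over S' \ S is controlled by the squared
   Hilbert-Schmidt norm of B E(S' \ S), at most the increment of that of B E(S);
   the latter is monotone and bounded in S, so the truncated integrals converge. *)
Lemma spectral_integral_exists (sigma : set R) G C L : measurable sigma ->
  0 <= C -> 0 <= L -> (forall mu, sigma mu -> linear (G mu)) ->
  (forall mu, sigma mu -> opbound C (G mu)) ->
  (forall mu nu, sigma mu -> sigma nu ->
     opbound (L * `|mu - nu|) (fun x => G mu x - G nu x)) ->
  exists2 I, bounded_operator I & is_spectral_integral E sigma B' G I.
Proof.
move=> ms C0 L0 linG GC GL.
pose S a c := sigma `&` `[a, c[.
have mS a c : measurable (S a c) by apply: measurableI => //; exact: measurable_itv.
have Ss a c : S a c `<=` sigma by exact: subIsetl.
have Sac a c : S a c `<=` `[a, c[ by exact: subIsetr.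
have {}J a c : {J | is_integral_on (integrand E B' G) (S a c) J}.
  exact/cid/(integral_exists hE linB linB' adjB b0 hsB C0 L0 linG GC GL (mS a c) (Sac a c)).
pose K a c := sval (J a c).
have hK a c : is_integral_on (integrand E B' G) (S a c) (K a c) by exact: (svalP (J a c)).
pose W := [set hs_sqr E B (S p.1 p.2) | p in [set: R * R]].
have supW : has_sup W.
  split; first by exists (hs_sqr E B (S 0 0)), (0, 0).
  by exists (b ^+ 2) => _ [p _ <-]; exact: hs_sqr_le.
have tail e : 0 < e -> exists a0 c0, forall a c, a <= a0 -> c0 <= c ->
    opbound e (fun x => K a c x - K a0 c0 x).
  move=> e0; have C1 : 0 < C + 1 by rewrite ltr_wpDl.
  pose d := e / (C + 1); have d0 : 0 < d by rewrite divr_gt0.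
  have [_ [[a0 c0] _ <-] /= hW] := sup_adherent (exprn_gt0 2 d0) supW.
  exists a0, c0 => a c aa0 c0c.
  have sub : S a0 c0 `<=` S a c.
    move=> r [sr /=]; rewrite in_itv /= => /andP[h1 h2]; split=> //=.
    by rewrite in_itv /= (le_trans aa0 h1) (lt_le_trans h2 c0c).
  apply: opbound_le (integral_tail C0 L0 linG GC GL (mS a0 c0) (mS a c) sub
    (Ss a c) (Sac a c) (hK a0 c0) (hK a c)).
  have cut : hs_cut E B (S a c `\` S a0 c0) <= d.
    rewrite -[d]ger0_norm ?(ltW d0)// -sqrtr_sqr ler_sqrt ?sqr_ge0//.
    have h1 := hs_sqr_setD hE hsB (mS a0 c0) (mS a c) sub.
    have h2 : hs_sqr E B (S a c) <= sup W.
      by apply: sup_ubound; [case: supW|exists (a, c)].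
    lra.
  apply: le_trans (ler_wpM2l C0 cut) _.
  by rewrite mulrA ler_pdivrMr// mulrC ler_wpM2l ?(ltW e0)// lerDl.
(* A sequence of truncations for [operator_complete]; the others are compared with it through
   [K a0 c0]. *)
pose X n := K (- n%:R) n%:R.
have bX n : bounded_operator (X n) by case: (hK (- n%:R) n%:R).
have nat_large (a0 c0 : R) : exists N, forall n, (N <= n)%N ->
    - n%:R <= a0 /\ c0 <= n%:R.
  exists (Num.bound (`|a0| + `|c0|)) => n hn.
  have : `|a0| + `|c0| < n%:R.
    apply: lt_le_trans (archi_boundP _) _; first by rewrite addr_ge0.
    by rewrite ler_nat.
  have := ler_norm (- a0); have := ler_norm c0; rewrite normrN.
  have := normr_ge0 a0; have := normr_ge0 c0 => *.
  by split; lra.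
have [e e0|I bI XI] := operator_complete bX.
  have [a0 [c0 h]] := tail _ (divr_gt0 e0 (ltr0Sn _ 1)).
  have [N hN] := nat_large a0 c0; exists N => m n /hN[m1 m2] /hN[n1 n2] x.
  apply: le_trans (ler_rdist _ (K a0 c0 x) _) _.
  rewrite [e]splitr mulrDl lerD//; first exact: h.
  by rewrite rdistC; exact: h.
exists I => //; exists K => [a c _|eps eps0]; first exact: hK.
have e4 : 0 < eps / 4 by rewrite divr_gt0.
have [a0 [c0 h]] := tail _ e4.
have [N hN] := nat_large a0 c0; have [N' hN'] := XI _ e4.
have [n1 n2] := hN (maxn N N') (leq_maxl _ _).
have hX := hN' (maxn N N') (leq_maxr _ _).
apply/near_infty2; exists a0, c0 => a c aa0 c0c.
apply: (@opbound_opnorm_lt _ _ _ _ (eps / 4 + eps / 4 + eps / 4)); [lra|lra|].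
move=> x; apply: le_trans (ler_rdist _ (K a0 c0 x) _) _.
apply: le_trans (lerD (lexx _) (ler_rdist _ (X (maxn N N') x) _)) _.
rewrite addrA !mulrDl !lerD//; first exact: (h _ _ (ltW aa0) (ltW c0c)).
by rewrite rdistC; exact: h.
Qed.

End SpectralIntegrals.

(** This trades the unspecified basis behind [hs_norm] for a real number [b] and an estimate that
    mentions no basis. *)
Lemma hilbert_schmidt_norm (R : realType) (U V : hilbertType R) (T : U -> V) :
  hilbert_schmidt T ->
  exists b : R, [/\ 0 <= b, hs_norm T = b%:E &
    forall (I : finType) (f : I -> U),
      (forall i, rnorm (f i) <= 1) -> (forall i j, i != j -> ip (f i) (f j) = 0) ->
      \sum_i rnorm (T (f i)) ^+ 2 <= b ^+ 2].
Proof.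
move=> [/bounded_operatorP [linT [M M0 TM]]]; rewrite /hs_norm.
set S := xget _ _ => Tfin.
have hS : orthonormal_basis S.
  by rewrite /S; apply: xgetPex; exact: orthonormal_basis_exists.
move: Tfin; set s := \esum_(e in S) _ => Tfin.
have s0 : (0 <= s)%E by apply: esum_ge0 => e _; rewrite lee_fin sqr_ge0.
have sfin : s \is a fin_num.
  by rewrite -sqrte_fin_num// ge0_fin_numE// sqrte_ge0.
have [r rs] : exists r, s = r%:E by exists (fine s); rewrite fineK.
have r0 : 0 <= r by rewrite -lee_fin -rs.
exists (Num.sqrt r); split; [exact: sqrtr_ge0|by rewrite rs|].
move=> I f f1 f0; rewrite sqr_sqrtr//.
apply: (hilbert_schmidt_sum_le hS linT M0 TM) => // F [uF FS].
rewrite -lee_fin -rs; apply: esum_ge; exists [set` F].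
  by split; [exact: finite_seq|exact: FS].
by rewrite -fsbig_seq// sumEFin.
Qed.

(** * The contraction on the operator ball *)

Section SolvabilityInBall.
Variables (R : realType) (U V : hilbertType R).
Variables (A : operator U) (Ab : operator V) (E : set R -> V -> V).
Variables (Bab : V -> U) (Bba : U -> V) (b d delta : R).
Hypotheses (sA : self_adjoint A) (linAb : linear_operator Ab).
Hypothesis hE : is_projection_valued_measure E.
Hypotheses (linBab : linear Bab) (linBba : linear Bba).
Hypothesis adjB : is_adjoint Bab Bba.
Hypothesis hsB : forall (I : finType) (f : I -> V),
  (forall i, rnorm (f i) <= 1) -> (forall i j, i != j -> ip (f i) (f j) = 0) ->
  \sum_i rnorm (Bab (f i)) ^+ 2 <= b ^+ 2.
Hypotheses (b0 : 0 <= b) (d0 : 0 < d) (delta0 : 0 < delta).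
Hypothesis bd : b * (1 + delta) < d.
Hypothesis bdelta : b * (1 + delta ^+ 2) < d * delta.

Let sigma := real_spectrum Ab.

Hypothesis gap : forall mu nu : R, sigma mu -> `|nu - mu| < d ->
  resolvent_set A nu%:C.

Let Y (Q : U -> V) := add_operator A (Bab \o Q).
Let G (Q : U -> V) (mu : R) := resolvent (Y Q) mu%:C.
Let C := (d - b * delta)^-1.

(** A single vector is an orthogonal family, so the Hilbert-Schmidt bound dominates the operator
    norm. *)
Lemma opbound_Bab : opbound b Bab.
Proof.
apply: opbound_unit => // x x1; rewrite -ler_sqr ?nnegrE ?rnorm_ge0//.
have := @hsB 'I_1 (fun=> x); rewrite big_ord1; apply=> // i j.
by rewrite !ord1 eqxx.
Qed.

Lemma gap_pos : 0 < d - b * delta.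
Proof. by rewrite subr_gt0; apply: le_lt_trans bd; rewrite mulrDr mulr1 lerDr. Qed.

Lemma C_ge0 : 0 <= C. Proof. by rewrite invr_ge0 ltW// gap_pos. Qed.

Lemma Cb_lt1 : C * b < 1.
Proof.
rewrite /C mulrC ltr_pdivrMr ?gap_pos// mul1r ltrBrDr.
by move: bd; rewrite mulrDr mulr1.
Qed.

Lemma Cb_le : C * b <= delta.
Proof.
rewrite /C mulrC ler_pdivrMr ?gap_pos// mulrBr lerBrDr; apply/ltW.
by move: bdelta; rewrite mulrDr mulr1 expr2 mulrCA [d * _]mulrC.
Qed.

Lemma resolventQ Q mu : bounded_operator Q -> opbound delta Q -> sigma mu ->
  is_resolvent (Y Q) mu%:C (G Q mu) /\ opbound C (G Q mu).
Proof.
move=> [linQ _] Qd smu.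
have [T rT] : resolvent_set A mu%:C by apply: (gap smu); rewrite subrr normr0.
have Td : opbound d^-1 T.
  by apply: (self_adjoint_resolvent_bound sA d0 rT) => nu; exact: gap.
have [linA _ _] := sA.
have linK : linear (Bab \o Q) by move=> c x y /=; rewrite linQ linBab.
have bdel0 : 0 <= b * delta by rewrite mulr_ge0// ltW.
have Kbd : opbound (b * delta) (Bab \o Q).
  move=> x /=; apply: le_trans (opbound_Bab _) _.
  by rewrite -mulrA ler_wpM2l.
have id0 : 0 <= d^-1 by rewrite invr_ge0 ltW.
have [|T' rT' T'C] := resolvent_perturbation linA rT linK id0 bdel0 Td Kbd.
  by rewrite mulrC ltr_pdivrMr// mul1r -subr_gt0 gap_pos.
have GT : G Q mu = T' by exact: resolventE.
rewrite GT; split=> //; rewrite /C (_ : (_ - _)^-1 = d^-1 / (1 - d^-1 * (b * delta)))//.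
by rewrite -invfM mulrBr mulr1 mulrA divff ?mul1r// gt_eqF.
Qed.

Lemma G_linear Q mu : bounded_operator Q -> opbound delta Q -> sigma mu ->
  linear (G Q mu).
Proof. by move=> bQ Qd /(resolventQ bQ Qd) [[[]]]. Qed.

Lemma G_lipschitz Q mu nu : bounded_operator Q -> opbound delta Q ->
  sigma mu -> sigma nu ->
  opbound (C * C * `|mu - nu|) (fun x => G Q mu x - G Q nu x).
Proof.
move=> bQ Qd /(resolventQ bQ Qd) [r2 h2] /(resolventQ bQ Qd) [r1 h1] x.
rewrite (resolvent_identity x r1 r2) subrr add0r -rmorphB /=.
apply: le_trans (h1 _) _; rewrite rnormZr -!mulrA ler_wpM2l ?C_ge0//.
by rewrite mulrCA ler_wpM2l.
Qed.

Lemma G_diff Q Q' c mu : bounded_operator Q -> opbound delta Q ->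
  bounded_operator Q' -> opbound delta Q' -> 0 <= c ->
  opbound c (fun x => Q x - Q' x) -> sigma mu ->
  opbound (C * b * C * c) (fun x => G Q mu x - G Q' mu x).
Proof.
move=> bQ Qd bQ' Q'd c0 QQ' smu x.
have [r2 h2] := resolventQ bQ Qd smu; have [r1 h1] := resolventQ bQ' Q'd smu.
rewrite (resolvent_identity x r1 r2) subrr scale0r addr0 /=.
apply: le_trans (h1 _) _; rewrite -(linear_mapB linBab) -!mulrA ler_wpM2l ?C_ge0//.
apply: le_trans (opbound_Bab _) _; rewrite ler_wpM2l// rdistC.
by apply: le_trans (QQ' _) _; rewrite mulrCA ler_wpM2l.
Qed.

Let integral Q := [set I | bounded_operator I /\
  is_spectral_integral E sigma Bba (G Q) I].
(** The right-hand side of the equation as a function of [Q]. It is meaningful on the ball, by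
    [Phi_integral]; elsewhere it may be the default 0. *)
Let Phi Q := xget (fun=> 0) (integral Q).

Lemma measurable_sigma : measurable sigma.
Proof. exact: measurable_real_spectrum. Qed.

Lemma Phi_integral Q : bounded_operator Q -> opbound delta Q ->
  integral Q (Phi Q).
Proof.
move=> bQ Qd; apply: xgetPex.
have [|||||I bI hI] := @spectral_integral_exists _ _ _ _ hE _ _ _ linBab linBba
  adjB b0 hsB sigma (G Q) C (C * C) measurable_sigma.
- exact: C_ge0.
- by rewrite mulr_ge0 ?C_ge0.
- by move=> mu; exact: G_linear.
- by move=> mu /(resolventQ bQ Qd) [].
- by move=> mu nu; exact: G_lipschitz.
by exists I.
Qed.

Lemma integral_diff Q Q' I I' c : bounded_operator Q -> opbound delta Q ->
  bounded_operator Q' -> opbound delta Q' -> 0 <= c ->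
  opbound c (fun x => Q x - Q' x) -> integral Q I -> integral Q' I' ->
  opbound ((C * b) * (C * b) * c) (fun x => I x - I' x).
Proof.
move=> bQ Qd bQ' Q'd c0 QQ' [[linI _] hI] [[linI' _] hI'].
have -> : (C * b) * (C * b) * c = C * b * C * c * b by ring.
apply: (spectral_integral_stable hE linBab linBba adjB b0 hsB measurable_sigma
  _ _ _ _ linI linI' hI hI').
- by rewrite !mulr_ge0// C_ge0.
- by move=> mu; exact: G_linear.
- by move=> mu; exact: G_linear.
- by move=> mu; exact: G_diff.
Qed.

(** Comparison with the integral of the zero family: the bound [C] on the resolvents gives [C b],
    which is at most [delta]. *)
Lemma integral_bound Q I : bounded_operator Q -> opbound delta Q ->
  integral Q I -> opbound delta I.
Proof.
move=> bQ Qd [[linI _] hI]; apply: (opbound_le Cb_le) => x.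
rewrite -[I x]subr0.
have lin0 (W : hilbertType R) : linear (fun _ : U => 0 : W).
  by move=> c u v; rewrite scaler0 addr0.
apply: (spectral_integral_stable hE linBab linBba adjB b0 hsB measurable_sigma
  C_ge0 _ _ _ linI (lin0 V) hI (spectral_integral0 hE linBba sigma)).
- by move=> mu; exact: G_linear.
- by move=> mu _; exact: lin0.
- by move=> mu /(resolventQ bQ Qd) [_ h] y; rewrite subr0; exact: h.
Qed.

Lemma unique_solution_in_ball : exists! Q : U -> V,
  operator_ball delta Q /\ is_solution A E sigma Bab Bba Q.
Proof.
have delta1 := ltW delta0.
have q01 : 0 <= (C * b) * (C * b) < 1.
  have Cb0 : 0 <= C * b by rewrite mulr_ge0// C_ge0.
  by rewrite mulr_ge0//= -expr2 expr_lt1// Cb_lt1.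
have Phiq X X' c : bounded_operator X -> opbound delta X ->
    bounded_operator X' -> opbound delta X' -> 0 <= c ->
    opbound c (fun x => X x - X' x) ->
    opbound ((C * b) * (C * b) * c) (fun x => Phi X x - Phi X' x).
  move=> bX Xd bX' X'd c0 XX'; apply: (integral_diff bX Xd bX' X'd c0 XX').
    exact: Phi_integral.
  exact: Phi_integral.
(* A solution is an integral of its own resolvent family, and [integral_diff] with [c = 0]
   identifies it with the integral that [Phi] picks. *)
have fix_unique Q : bounded_operator Q -> opbound delta Q -> integral Q Q -> Phi Q = Q.
  move=> bQ Qd iQ; apply/funext => x; apply/subr0_eq/rnorm_eq0.
  have QQ : opbound 0 (fun x => Q x - Q x).
    by move=> y; rewrite subrr rnorm0 mul0r.
  have := integral_diff bQ Qd bQ Qd (lexx 0) QQ (Phi_integral bQ Qd) iQ x.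
  by rewrite mulr0 mul0r => h; apply/le_anti; rewrite h rnorm_ge0.
have [X bX Xd|Q [bQ Qd PQ]] := operator_fixpoint delta1 q01 _ Phiq.
  have [bP hP] := Phi_integral bX Xd.
  by split=> //; apply: (integral_bound bX Xd).
exists Q; split.
  split; first by split=> //; exact: opbound_opnorm.
  split.
  - by move=> mu smu; exists (G Q mu); have [] := resolventQ bQ Qd smu.
  - apply: (@le_lt_trans _ _ C%:E); last exact: ltry.
    apply: ge_ereal_sup => _ [mu smu <-]; apply: opbound_opnorm; first exact: C_ge0.
    by have [] := resolventQ bQ Qd smu.
  - by have [_] := Phi_integral bQ Qd; rewrite PQ.
move=> Q' [[bQ' Q'd] [_ _ hQ']].
have {}Q'd : opbound delta Q' by apply: opnorm_le => //; case: bQ'.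
by apply: (operator_fixpoint_uniq delta1 q01 Phiq) => //; exact: fix_unique.
Qed.

End SolvabilityInBall.

Theorem theorem1 (R : realType) (H : 'I_2 -> hilbertType R)
    (A : forall i, operator (H i)) (alpha beta : 'I_2)
    (E : set R -> H beta -> H beta)
    (Bab : H beta -> H alpha) (Bba : H alpha -> H beta)
    (d0 := set_dist (spectrum (A ord0)) (spectrum (A ord_max)))
    (sigma := real_spectrum (A beta)) :
  beta != alpha ->
  (forall i, self_adjoint (A i)) ->
  (0 < d0)%E ->
  hilbert_schmidt Bab ->
  bounded_operator Bba -> is_adjoint Bab Bba ->
  is_spectral_measure E (A beta) ->
  (forall delta : R, 0 < delta ->
     (hs_norm Bab < d0 * (Num.min (1 / (1 + delta))
                                  (delta / (1 + delta ^+ 2)))%:E)%E ->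
     exists! Q : H alpha -> H beta,
       operator_ball delta Q /\
       is_solution (A alpha) E sigma Bab Bba Q) /\
  ((hs_norm Bab < (1 / 2)%:E * d0)%E ->
     exists! Q : H alpha -> H beta,
       operator_ball 1 Q /\
       is_solution (A alpha) E sigma Bab Bba Q).
Proof.
move=> ba sA d0_gt0 hsBab [linBba _] adjB [hE _ _].
have [b [b0 bE hsB]] := hilbert_schmidt_norm hsBab.
have [[linBab _] _] := hsBab.
have [linAb _ _] := sA beta.
have ord2 (i : 'I_2) : i = ord0 \/ i = ord_max.
  by case: i => [[|[|//]] ?]; [left|right]; apply: val_inj.
(* [d0] is taken in a fixed order of the two spectra; symmetry of the distance makes it available
   for either choice of [alpha] and [beta]. *)
have distE (i j : 'I_2) : i != j -> forall x y, spectrum (A i) x -> spectrum (A j) y ->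
    (d0 <= (rnorm (x - y : R[i]))%:E)%E.
  case: (ord2 i) => ->; case: (ord2 j) => -> //= _ x y sx sy.
    by apply: ereal_inf_lbound; exists (x, y).
  by rewrite rdistC; apply: ereal_inf_lbound; exists (y, x).
have main (delta : R) : 0 < delta ->
    (hs_norm Bab < d0 * (Num.min (1 / (1 + delta))
                                 (delta / (1 + delta ^+ 2)))%:E)%E ->
    exists! Q : H alpha -> H beta,
      operator_ball delta Q /\ is_solution (A alpha) E sigma Bab Bba Q.
  move=> delta0; set m := Num.min _ _; rewrite bE => bm.
  have p1 : 0 < 1 + delta by rewrite addr_gt0.
  have p2 : 0 < 1 + delta ^+ 2 by rewrite ltr_pwDl// sqr_ge0.
  have m0 : 0 < m by rewrite lt_min !divr_gt0.
  (* [d0] is [+oo] when a spectrum is empty. Any positive real [d] with [d m > b] then serves, and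
     [(b + 1) / m] is one. *)
  have [d [d_gt0 dd0 bdm]] : exists d : R, [/\ 0 < d, (d%:E <= d0)%E & b < d * m].
    move: d0_gt0 bm; case: d0 distE => [r _ r0 bm|_ _ _|//].
      by exists r.
    exists ((b + 1) / m); split; first by rewrite divr_gt0// ltr_wpDl.
      exact: leey.
    by rewrite divfK ?gt_eqF// ltrDl.
  apply: (unique_solution_in_ball (sA alpha) linAb hE linBab linBba adjB hsB b0
    d_gt0 delta0).
  - rewrite -ltr_pdivlMr//; apply: lt_le_trans bdm _.
    by rewrite ler_wpM2l ?(ltW d_gt0)// -div1r ge_min lexx.
  - rewrite -ltr_pdivlMr//; apply: lt_le_trans bdm _.
    by rewrite -mulrA ler_wpM2l ?(ltW d_gt0)// ge_min lexx orbT.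
  - move=> mu nu smu numu; apply: contrapT => nres.
    have ab : alpha != beta by rewrite eq_sym.
    have := distE _ _ ab _ _ nres smu.
    rewrite -rmorphB /= rnorm_real => /(le_trans dd0); rewrite lee_fin.
    by rewrite leNgt numu.
(* At [delta = 1] both terms of the minimum are [1 / 2]. *)
split=> // h; apply: main => //; move: h.
by rewrite expr1n /Num.min ltxx muleC.
Qed.
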